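(* Let $\phi:\mathbb{R}^n\to\mathbb{R}^r$ be an embedding with $\phi(x_0)=y_0$. Then the It\^o-jet projection onto $\phi(\mathbb{R}^n)$, in the coordinates $x$, of the It\^o SDE $$dy=a\,dt+b_\alpha\,dW^\alpha_t,\qquad y_0,$$ on $\mathbb{R}^r$ is $$dx=A\,dt+B_\alpha\,dW^\alpha_t,\qquad x_0,$$ where $$B^i_\alpha=\Pi^i_\beta\,b^\beta_\alpha$$ and $$A^i=\Pi^i_\alpha a^\alpha+\Big(-\tfrac12\frac{\partial^2\phi^\gamma}{\partial x^\alpha\partial x^\beta}\Pi^i_\gamma\Pi^\alpha_\delta\Pi^\beta_\epsilon+\frac{\partial^2\phi^\epsilon}{\partial x^\alpha\partial x^\beta}\Pi^\beta_\delta h^{i\alpha}-\frac{\partial^2\phi^\gamma}{\partial x^\alpha\partial x^\beta}\Pi^\beta_\epsilon\Pi^\eta_\gamma\Pi^\zeta_\delta h_{\eta\zeta}h^{i\alpha}\Big)\,b^\delta_\kappa b^\epsilon_\iota\,\delta^{\kappa\iota}.$$ Here $a,b$ are evaluated at $\phi(x)$, and the derivatives of $\phi$, $h$ and $\Pi$ are evaluated at $x$.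
   Context: $W^\alpha$ are independent standard Brownian motions. The Einstein convention is extended: an index appearing twice in a product is summed, over the smaller of the ranges ($1..n$ or $1..r$) to which it may belong (regardless of whether both occurrences are upper). Indices referring to $x\in\mathbb{R}^n$ run over $1..n$, components in $\mathbb{R}^r$ over $1..r$, Brownian indices over the number of Brownian motions. Define $$h_{ab}=\sum_{\alpha=1}^r\frac{\partial\phi^\alpha}{\partial x^a}\frac{\partial\phi^\alpha}{\partial x^b}\ (1\le a,b\le n),\qquad (h^{ab})=(h_{ab})^{-1},\qquad \Pi^a_b=\sum_{\alpha=1}^n\frac{\partial\phi^b}{\partial x^\alpha}h^{a\alpha}\ (a\le n,\ b\le r).$$ It\^o-jet projection: the metric projection $\Pi^s$ sends a point of a tubular neighbourhood of (a small open part of) $\phi(\mathbb{R}^n)$ to the nearest point of the submanifold. A family of smooth maps $\gamma_y:\mathbb{R}^k\to P$ into a manifold with $\gamma_y(0)=y$ determines the SDE $dX^i=\frac12\sum_\alpha\frac{\partial^2\gamma^i}{\partial u^\alpha\partial u^\alpha}(X)\,dt+\sum_\alpha\frac{\partial\gamma^i}{\partial u^\alpha}(X)\,dW^\alpha_t$ in any chart (derivatives of $\gamma_X$ at $0$). If the SDE on $\mathbb{R}^r$ is represented by maps $\gamma_y$, its It\^o-jet projection is the SDE on $\phi(\mathbb{R}^n)$ determined by $\Pi^s\circ\gamma_y$ for $y\in\phi(\mathbb{R}^n)$ (expressed in coordinates $x$ via $\phi^{-1}$). *)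

(* Defs.v *)
From HB Require Import structures.
From mathcomp Require Import all_boot all_order all_algebra.
From mathcomp Require Import all_classical all_reals all_analysis.

Set Implicit Arguments.
Unset Strict Implicit.
Unset Printing Implicit Defensive.

Import Order.TTheory GRing.Theory Num.Theory.
Import numFieldNormedType.Exports.

Local Open Scope classical_set_scope.
Local Open Scope ring_scope.

Section Calculus.
Context {R : realType}.

Definition partial {m d : nat} (f : 'rV[R]_m -> 'rV[R]_d) (i : 'I_m) :
    'rV[R]_m -> 'rV[R]_d :=
  fun x => 'D_(delta_mx 0 i) f x.

(* C^k regularity on an open set O. *)
Fixpoint Ck_on {m d : nat} (k : nat) (O : set 'rV[R]_m)
    (f : 'rV[R]_m -> 'rV[R]_d) : Prop :=
  match k with
  | 0%N => forall x, O x -> {for x, continuous f}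
  | k'.+1 => (forall x, O x -> differentiable f x) /\
             (forall i : 'I_m, Ck_on k' O (partial f i))
  end.

Definition smooth_on {m d : nat} (O : set 'rV[R]_m)
    (f : 'rV[R]_m -> 'rV[R]_d) : Prop :=
  forall k, Ck_on k O f.

(* Injective immersion that is a homeomorphism onto its image; since phi is
   injective, [pinv setT phi] is the inverse of phi on [range phi]. *)
Definition smooth_embedding {n r : nat} (phi : 'rV[R]_n -> 'rV[R]_r) : Prop :=
  [/\ smooth_on setT phi,
      injective phi,
      forall x, injective ('d phi x : 'rV[R]_n -> 'rV[R]_r) &
      {within range phi, continuous (pinv setT phi)}].

(* The norm that the library puts on row vectors is the sup norm, so the
   Euclidean distance has to be spelled out. *)
Definition euclidean_dist {d : nat} (y z : 'rV[R]_d) : R :=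
  Num.sqrt (\sum_(i < d) (y 0 i - z 0 i) ^+ 2).

Definition nearest_point {d : nat} (M : set 'rV[R]_d) (y p : 'rV[R]_d) : Prop :=
  M p /\ forall q, M q -> q <> p -> euclidean_dist y p < euclidean_dist y q.

(* Pis is the metric projection onto the part phi(U) of the submanifold, on an
   open neighbourhood V of phi x, hence of the part of the submanifold that lies
   in V. Both U = R^n and a small U are allowed; no regularity of Pis is
   assumed, and its values outside V are irrelevant. *)
Definition metric_projection_near {n r : nat} (phi : 'rV[R]_n -> 'rV[R]_r)
    (x : 'rV[R]_n) (Pis : 'rV[R]_r -> 'rV[R]_r) : Prop :=
  exists U V, [/\ open_nbhs x U, open_nbhs (phi x) V &
    forall y, V y -> nearest_point (phi @` U) y (Pis y)].

End Calculus.

(* The Ito SDE dX = drift(X) dt + sum_(al < k) diffusion al (X) dW^al,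
   X_0 = init, in R^d, given by its data. *)
Record sde (R : realType) (d k : nat) := Sde {
  drift : 'rV[R]_d -> 'rV[R]_d;
  diffusion : 'I_k -> 'rV[R]_d -> 'rV[R]_d;
  init : 'rV[R]_d }.

Section ItoJets.
Context {R : realType}.

(* The coefficients at y of the SDE S are those determined by the 2-jet at 0 of
   the map g, smooth on O, with g 0 = y. *)
Definition determines_at {d k : nat} (O : set 'rV[R]_k)
    (g : 'rV[R]_k -> 'rV[R]_d) (S : sde R d k) (y : 'rV[R]_d) : Prop :=
  [/\ smooth_on O g,
      g 0 = y,
      drift S y = 2^-1 *: \sum_(al < k) partial (partial g al) al 0 &
      forall al, diffusion S al y = partial g al 0].

Definition represents {d k : nat} (gamma : 'rV[R]_d -> 'rV[R]_k -> 'rV[R]_d)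
    (S : sde R d k) : Prop :=
  forall y, determines_at setT (gamma y) S y.

(* T, on R^n, is the Ito-jet projection of S onto phi(R^n), in the coordinates
   given by phi^-1. The projected maps are only defined where gamma takes its
   values in the domain of the metric projection, hence near 0. *)
Definition is_ito_jet_projection {n r k : nat} (phi : 'rV[R]_n -> 'rV[R]_r)
    (S : sde R r k) (T : sde R n k) : Prop :=
  phi (init T) = init S /\
  forall x,
    (exists Pis, metric_projection_near phi x Pis) /\
    forall gamma Pis, represents gamma S -> metric_projection_near phi x Pis ->
      exists2 O : set 'rV[R]_k, open_nbhs (0 : 'rV[R]_k) O &
        determines_at O (pinv setT phi \o Pis \o gamma (phi x)) T x.

Section Coefficients.
Context {n r : nat} (phi : 'rV[R]_n -> 'rV[R]_r) (x : 'rV[R]_n).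

(* d1 a c = d phi^c / d x^a and d2 a b c = d^2 phi^c / d x^a d x^b. *)
Definition d1 (a : 'I_n) (c : 'I_r) : R := partial phi a x 0 c.

Definition d2 (a b : 'I_n) (c : 'I_r) : R :=
  partial (partial phi b) a x 0 c.

Definition h_mx : 'M[R]_n := \matrix_(a, b) \sum_(al < r) d1 a al * d1 b al.

(* The entry (a, b) is Pi^a_b; h^{ab} is the entry (a, b) of [invmx h_mx]. *)
Definition Pi_mx : 'M[R]_(n, r) :=
  \matrix_(a, b) \sum_(al < n) d1 al b * invmx h_mx a al.

End Coefficients.
End ItoJets.

(* Main.v *)
Require Import Defs.
From HB Require Import structures.
From mathcomp Require Import all_boot all_order all_algebra.
From mathcomp Require Import all_classical all_reals all_analysis.
From mathcomp Require Import ring lra.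

(** The projection of a point [y] near [phi x] is [phi t], where [t] minimises
    the squared distance from [y] to [phi t], and such a [t] solves the
    stationarity equations
      sum_c (y^c - phi^c(t)) d_a phi^c(t) = 0    for every index a.
    The left-hand side is [tangential phi y t a]: the residual [y - phi t],
    tested against the tangent vectors.  All the geometry is in these equations.

    Their Jacobian in [t] is minus the matrix
      M_ab(y, t) = h_ab(t) - sum_c (y^c - phi^c(t)) d_b d_a phi^c(t),
    half the Hessian of the squared distance.  At [(phi x, x)] it is the Gram
    matrix [h], which is positive definite because [phi] is an immersion
    ([gram_coercive]); by continuity [M] is uniformly positive definite near
    that point.  The mean value theorem turns this into a strong monotonicity
    of the residual in [t] ([tangential_monotone]), and monotonicity replaces
    the implicit function theorem: it makes the stationary parameter unique,
    Lipschitz in [y], hence differentiable with derivative M^-1 (d phi), and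
    this formula, being smooth in [(y, t)], bootstraps to all orders
    ([stationary_Ck]).

    A minimiser over a compact ball exists, and it is an interior point because
    [phi^-1] is continuous on the image: a point of the image that is at least
    as close to [y] as [phi x] has its parameter near [x] ([closer_point_near]).
    With uniqueness this gives a metric projection ([metric_projection_exists]);
    the same remark shows that any metric projection whatsoever is given near
    [phi x] by the smooth stationary parameter ([metric_projection_smooth]).

    Now let [gamma] represent the equation at [phi x] and let [T] be the
    stationary parameter of [gamma].  The identity
      sum_c (gamma^c - phi^c(T)) d_a phi^c(T) = 0
    holds near 0, and the first factor vanishes at 0.  Differentiating it once
    and twice along a coordinate at 0 and solving the resulting linear systems,
    both with matrix [h], gives the first and second derivatives of [T]
    ([stationary_jet1], [stationary_jet2]) without differentiating the inverse
    of [h].  Summing the second derivatives over the Brownian indices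
    and expanding T' = Pi gamma' gives the drift ([jet_contraction]).  The second
    derivatives of [phi] appear in the two index orders, so their symmetry
    ([derive_commute]) is used. *)

Set Implicit Arguments.
Unset Strict Implicit.
Unset Printing Implicit Defensive.

Import Order.TTheory GRing.Theory Num.Theory.
Import numFieldNormedType.Exports.

Local Open Scope classical_set_scope.
Local Open Scope ring_scope.

(** * Norms of row vectors and finite families of neighbourhoods *)

Section RowVectors.
Context {R : realType}.

Lemma norm_coord_le (d : nat) (v : 'rV[R]_d) j : `|v 0 j| <= `|v|.
Proof.
by rewrite [leRHS]/Num.Def.normr/= mx_normrE; apply: (le_bigmax _ _ (0, j)).
Qed.

Lemma norm_row_le (d : nat) (v : 'rV[R]_d) e :
  0 <= e -> (forall j, `|v 0 j| <= e) -> `|v| <= e.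
Proof.
move=> e0 ve; rewrite [leLHS]/Num.Def.normr/= mx_normrE bigmax_le// => -[i j] _.
by rewrite ord1; apply: ve.
Qed.

(** The squared Euclidean norm, as opposed to the square of the sup norm. *)
Definition sqnorm d (v : 'rV[R]_d) : R := \sum_i v 0 i ^+ 2.

Lemma sqnorm_ge0 d (v : 'rV[R]_d) : 0 <= sqnorm v.
Proof. by apply: sumr_ge0 => i _; exact: sqr_ge0. Qed.

Lemma sqr_coord_le d (v : 'rV[R]_d) i : v 0 i ^+ 2 <= sqnorm v.
Proof.
by rewrite /sqnorm (bigD1 i)//= lerDl; apply: sumr_ge0 => j _; exact: sqr_ge0.
Qed.

Lemma sqnorm_eq0 d (v : 'rV[R]_d) : sqnorm v <= 0 -> v = 0.
Proof.
move=> v0; apply/rowP => i; rewrite mxE; apply/eqP; rewrite -sqrf_eq0.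
by rewrite eq_le sqr_ge0 andbT (le_trans (sqr_coord_le v i)).
Qed.

Lemma norm_sqr_le d (v : 'rV[R]_d) : `|v| ^+ 2 <= sqnorm v.
Proof.
rewrite -[leRHS]sqr_sqrtr ?sqnorm_ge0// ler_sqr ?nnegrE ?sqrtr_ge0//.
apply: norm_row_le => [|j]; first exact: sqrtr_ge0.
by rewrite -sqrtr_sqr ler_wsqrtr// sqr_coord_le.
Qed.

Lemma sqnorm_le d (v : 'rV[R]_d) : sqnorm v <= d%:R * `|v| ^+ 2.
Proof.
have -> : d%:R * `|v| ^+ 2 = \sum_(i < d) `|v| ^+ 2.
  by rewrite sumr_const card_ord mulr_natl.
apply: ler_sum => i _; rewrite -real_normK ?num_real//.
by rewrite ler_sqr ?nnegrE// norm_coord_le.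
Qed.

(** Comparison of the Euclidean and sup norms with the crude factor [d + 1] in
    place of the square root of [d]. *)
Lemma norm_le_of_sqnorm d (u v : 'rV[R]_d) :
  sqnorm u <= sqnorm v -> `|u| <= d.+1%:R * `|v|.
Proof.
move=> uv; apply: norm_row_le => [|j]; first exact: mulr_ge0.
rewrite -ler_sqr ?nnegrE ?mulr_ge0// real_normK ?num_real//.
rewrite (le_trans (sqr_coord_le u j))// (le_trans uv)//.
rewrite (le_trans (sqnorm_le v))// exprMn ler_wpM2r ?sqr_ge0//.
by rewrite -natrX ler_nat (leq_trans (leqnSn d))// -mulnn leq_pmulr.
Qed.

Lemma euclidean_distE d (y z : 'rV[R]_d) :
  euclidean_dist y z = Num.sqrt (sqnorm (y - z)).
Proof. by congr Num.sqrt; apply: eq_bigr => i _; rewrite !mxE. Qed.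

Lemma euclidean_dist_le d (y z w : 'rV[R]_d) :
  (euclidean_dist y z <= euclidean_dist y w) = (sqnorm (y - z) <= sqnorm (y - w)).
Proof. by rewrite !euclidean_distE ler_psqrt ?nnegrE ?sqnorm_ge0. Qed.

Lemma ball_convex n (x s t : 'rV[R]_n) d th : 0 <= th <= 1 ->
  ball x d s -> ball x d t -> ball x d (s + th *: (t - s)).
Proof.
move=> /andP[th0 th1]; rewrite -ball_normE/= => xs xt.
have -> : x - (s + th *: (t - s)) = (1 - th) *: (x - s) + th *: (x - t).
  rewrite !scalerBr !scalerBl !scale1r; apply/rowP => i; rewrite !mxE; ring.
rewrite (le_lt_trans (ler_normD _ _))// !normrZ !ger0_norm ?subr_ge0//.
have [->|thn0] := eqVneq th 0; first by rewrite subr0 mul1r mul0r addr0.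
have -> : d = (1 - th) * d + th * d by ring.
apply: ler_ltD.
  by apply: ler_wpM2l; [rewrite subr_ge0|exact: ltW].
by rewrite ltr_pM2l// lt_def thn0.
Qed.

End RowVectors.

Lemma near_forall {T : topologicalType} {I : finType} (P : I -> T -> Prop)
    (x : T) :
  (forall i, \forall z \near x, P i z) -> \forall z \near x, forall i, P i z.
Proof. exact: filter_forall. Qed.

Lemma near_entries {R : realType} {T : topologicalType} {I J : finType}
    (F : I -> J -> T -> R) x e : 0 < e ->
  (forall i j, {for x, continuous (F i j)}) ->
  \forall z \near x, forall i j, `|F i j x - F i j z| <= e.
Proof.
move=> e0 Fc; apply: filter_forall => i; apply: filter_forall => j.
by move/cvgrPdist_le : (Fc i j); exact.
Qed.

(** * Differentiation of functions of row vectors *)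

Section Derivatives.
Context {R : realType}.

Lemma frechet_criterion {V : normedModType R} (f : V -> R)
    (L : {linear V -> R}) x :
  continuous L ->
  (forall e, 0 < e -> \forall h \near 0,
     `|f (h + x) - f x - L h| <= e * `|h|) ->
  differentiable f x /\ 'd f x = L :> (V -> R).
Proof.
move=> Lc fL.
have E : f \o shift x = cst (f x) + L +o_ 0 id.
  apply/eqaddoP => e e0; apply: filterS (fL e e0) => h /=.
  by rewrite /cst !fctE opprD addrA.
have dE := diff_unique Lc E.
by split => //; apply/diff_locallyP; rewrite dE.
Qed.

Lemma differentiable_near_eq {V : normedModType R} (f g : V -> R) x :
  (\forall y \near x, f y = g y) -> differentiable f x -> differentiable g x.
Proof.
move=> fg df; have [dc dE] := (diff_locallyP _ _).1 df.
have fgx : f x = g x by apply: nbhs_singleton fg.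
apply: (proj1 (@frechet_criterion _ g ('d f x) x dc _)) => e e0.
move/eqaddoP : dE => /(_ e e0) dE.
move: fg; rewrite (near_shift 0) subr0 => fg.
near=> h.
have -> : g (h + x) = f (h + x) by have /= := near fg h; rewrite addrC => ->.
rewrite -fgx -addrA -opprD.
by near: h; apply: filterS dE => h; rewrite /cst !fctE.
Unshelve. all: by end_near. Qed.

Lemma differentiable_coordP {V : normedModType R} d (f : V -> 'rV[R]_d) x :
  differentiable f x <-> forall j, differentiable (fun y => f y 0 j) x.
Proof.
split=> [df j|df].
  by apply: (@differentiable_comp _ _ _ _ f (fun M : 'rV[R]_d => M 0 j : R)) => //;
    exact: differentiable_coord.
have -> : f = \sum_(j < d) (fun y => f y 0 j *: delta_mx 0 j).
  by apply/funext => y; rewrite [LHS]row_sum_delta fct_sumE.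
by apply: differentiable_sum => j; apply: differentiableZl.
Qed.

Lemma continuous_row {T : topologicalType} d (f : T -> 'rV[R]_d) x :
  (forall j, {for x, continuous (fun y => f y 0 j)}) -> {for x, continuous f}.
Proof.
move=> fc; apply/cvgrPdist_le => e e0.
have fj : \forall y \near x, forall j, `|f x 0 j - f y 0 j| <= e.
  by apply: filter_forall => j; move/cvgrPdist_le : (fc j); exact.
apply: filterS fj => y fy; apply: norm_row_le => [|j]; first exact: ltW.
by rewrite !mxE.
Qed.

Lemma derive_coord {V : normedModType R} d (f : V -> 'rV[R]_d) x v j :
  differentiable f x -> 'D_v f x 0 j = 'D_v (fun y => f y 0 j) x.
Proof. by move=> df; rewrite derive_mx ?mxE//; exact: diff_derivable. Qed.

Lemma derive_basis m (f : 'rV[R]_m -> R) x v : differentiable f x ->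
  'D_v f x = \sum_i v 0 i * 'D_(delta_mx 0 i) f x.
Proof.
move=> df; rewrite deriveE// {1}[v]row_sum_delta linear_sum/=.
by apply: eq_bigr => i _; rewrite linearZ/= deriveE.
Qed.

Lemma derive_chain m d (f : 'rV[R]_d -> R) (g : 'rV[R]_m -> 'rV[R]_d) x v :
  differentiable g x -> differentiable f (g x) ->
  'D_v (fun y => f (g y)) x =
  \sum_j 'D_v (fun y => g y 0 j) x * 'D_(delta_mx 0 j) f (g x).
Proof.
move=> dg df; rewrite deriveE; last exact: (differentiable_comp dg df).
rewrite (diff_comp dg df)/= -!deriveE// derive_basis//.
by apply: eq_bigr => j _; rewrite derive_coord.
Qed.

Lemma derive_pointM {V : normedModType R} (f g : V -> R) x v :
  differentiable f x -> differentiable g x ->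
  'D_v (fun y => f y * g y) x = f x * 'D_v g x + g x * 'D_v f x.
Proof. by move=> df dg; rewrite [LHS]deriveM//; exact: diff_derivable. Qed.

Lemma derive_pointB {V : normedModType R} (f g : V -> R) x v :
  differentiable f x -> differentiable g x ->
  'D_v (fun y => f y - g y) x = 'D_v f x - 'D_v g x.
Proof. by move=> df dg; rewrite [LHS]deriveB//; exact: diff_derivable. Qed.

Lemma derive_point_sum {V : normedModType R} m (F : 'I_m -> V -> R) x v :
  (forall i, differentiable (F i) x) ->
  'D_v (fun y => \sum_i F i y) x = \sum_i 'D_v (F i) x.
Proof.
move=> dF; rewrite -derive_sum; last by move=> i; exact: diff_derivable.
by congr ('D_v _ x); apply/funext => y; rewrite fct_sumE.
Qed.

Lemma is_derive_line {V : normedModType R} (f : V -> R) p v th :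
  derivable f (p + th *: v) v ->
  is_derive th 1 (fun s : R => f (p + s *: v)) ('D_v f (p + th *: v)).
Proof.
move=> dfth; set g := fun s : R => _.
have E : (fun h : R => h^-1 *: ((g \o shift th) (h *: 1) - g th)) =
    (fun h => h^-1 *: ((f \o shift (p + th *: v)) (h *: v) - f (p + th *: v))).
  apply/funext => h /=; rewrite /g /=; congr (_ *: (f _ - _)).
  by rewrite [h%:A]mulr1 scalerDl addrCA.
by apply: DeriveDef; rewrite /derivable /derive E.
Qed.

Lemma mean_value_line {V : normedModType R} (f : V -> R) p v s : 0 < s ->
  (forall th, 0 <= th <= s -> differentiable f (p + th *: v)) ->
  exists2 th, 0 < th < s & f (p + s *: v) - f p = s * 'D_v f (p + th *: v).
Proof.
move=> s0 df; pose g (th : R) := f (p + th *: v).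
have dg th : 0 <= th <= s -> is_derive th 1 g ('D_v f (p + th *: v)).
  by move=> ths; apply/is_derive_line/diff_derivable/df.
have [||th] := @MVT R g (fun th => 'D_v f (p + th *: v)) 0 s s0.
- by move=> th; rewrite in_itv/= => /andP[a b]; apply: dg; rewrite !ltW.
- apply: derivable_within_continuous => th; rewrite in_itv/= => ths.
  by have [] := dg _ ths.
rewrite in_itv/= => ths; rewrite /g scale0r addr0 subr0 => ->.
by exists th => //; rewrite mulrC.
Qed.

Lemma local_min_derive {V : normedModType R} (f : V -> R) (U : set V) x v :
  open U -> U x -> (forall y, differentiable f y) ->
  (forall y, U y -> f x <= f y) -> 'D_v f x = 0.
Proof.
move=> oU Ux df fmin.
pose l (h : R) := x + h *: v.
have l0 : l 0 = x by rewrite /l scale0r addr0.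
have lc : {for 0, continuous l}.
  apply: differentiable_continuous.
  by apply: differentiableD; [exact: differentiable_cst|exact: differentiableZl].
have Ul : \forall h \near (0 : R), U (l h).
  by apply: lc; rewrite l0; exact: open_nbhs_nbhs.
have [e /= e0 Ue] := (nbhs_ballP _ _).1 Ul.
have dfl (h : R) : is_derive h 1 (f \o l) ('D_v f (l h)).
  exact/is_derive_line/diff_derivable.
have [||||_ D0] := @derive1_at_min R (f \o l) (- e) e 0.
- by rewrite ge0_cp// ltW.
- by move=> h _; exact: ex_derive.
- by rewrite in_itv/= oppr_lt0 e0.
- move=> h; rewrite in_itv/= l0 => he; apply/fmin/Ue.
  by rewrite -ball_normE/= sub0r normrN ltr_norml.
by rewrite -D0 derive_val l0.
Qed.

End Derivatives.

(** * Symmetry of second derivatives *)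

Section Schwarz.
Context {R : realType} {V : normedModType R}.
Implicit Types (f : V -> R) (u v x : V).

(** The mixed second difference is symmetric in [u] and [v], while its expression
    through an intermediate point is not: comparing the two expressions is what
    makes the second derivatives commute.  The mean value theorem is applied along
    [u] to the increment of [f] in the direction [v], and then along [v]. *)
Lemma second_difference f u v x s : 0 < s ->
  (forall y, differentiable f y) ->
  (forall y, differentiable (fun z => 'D_u f z) y) ->
  exists2 p, `|p - x| <= s * (`|u| + `|v|) &
    f (x + s *: u + s *: v) - f (x + s *: u) - f (x + s *: v) + f x
    = s ^+ 2 * 'D_v (fun z => 'D_u f z) p.
Proof.
move=> s0 df ddf.
pose g y := f (y + s *: v) - f y.
have dfs y : differentiable (fun z => f (z + s *: v)) y.
  by apply: (@differentiable_comp _ _ _ _ (fun z => z + s *: v) f).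
have dg y : differentiable g y by apply: differentiableB.
have Dg y : 'D_u g y = 'D_u f (y + s *: v) - 'D_u f y.
  rewrite [LHS]deriveB; [|exact: diff_derivable..].
  congr (_ - _); rewrite !deriveE//.
  have -> : (fun z => f (z + s *: v)) = f \o (fun z => z + s *: v) by [].
  rewrite diff_comp//=; congr ('d f _ _).
  by rewrite -[(fun z => z + s *: v)]/(id + cst (s *: v)) diffD//= diff_cst
    addr0 diff_val.
have [th1 /andP[th10 th1s] E1] := @mean_value_line R V g x u s s0
  (fun th _ => dg _).
have [th2 /andP[th20 th2s] E2] := @mean_value_line R V (fun z => 'D_u f z)
  (x + th1 *: u) v s s0 (fun th _ => ddf _).
exists (x + th1 *: u + th2 *: v).
  rewrite [x + _]addrC addrAC addrK mulrDr (le_trans (ler_normD _ _))//.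
  by rewrite !normrZ !gtr0_norm// lerD// ler_wpM2r// ltW.
rewrite expr2 -mulrA -E2 -Dg -E1 /g.
by rewrite opprB addrA addrAC.
Qed.

Lemma eq_of_near_eq_values (F G : V -> R) x :
  {for x, continuous F} -> {for x, continuous G} ->
  (forall d, 0 < d -> exists p q, [/\ `|p - x| < d, `|q - x| < d & F p = G q]) ->
  F x = G x.
Proof.
move=> Fc Gc FG.
apply/eqP; rewrite -subr_eq0 -normr_eq0; apply/eqP/le_anti.
rewrite normr_ge0 andbT; apply/ler_addgt0Pr => e e0; rewrite add0r.
have e20 : 0 < e / 2 by rewrite divr_gt0.
have /(_ _) nF := (cvgrPdist_le _ _).1 Fc _ e20.
have /(_ _) nG := (cvgrPdist_le _ _).1 Gc _ e20.
have [dF /= dF0 {}nF] := (nbhs_ballP _ _).1 nF.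
have [dG /= dG0 {}nG] := (nbhs_ballP _ _).1 nG.
have [|p [q [px qx pq]]] := FG (Num.min dF dG).
  by rewrite lt_min dF0 dG0.
rewrite (le_trans (ler_distD (F p) _ _))// [leRHS](splitr e) lerD//.
  by apply: nF; rewrite -ball_normE/= distrC (lt_le_trans px)// ge_min lexx.
rewrite pq distrC; apply: nG.
by rewrite -ball_normE/= distrC (lt_le_trans qx)// ge_min lexx orbT.
Qed.

Lemma derive_commute f u v x :
  (forall y, differentiable f y) ->
  (forall y, differentiable (fun z => 'D_u f z) y) ->
  (forall y, differentiable (fun z => 'D_v f z) y) ->
  {for x, continuous (fun y => 'D_v (fun z => 'D_u f z) y)} ->
  {for x, continuous (fun y => 'D_u (fun z => 'D_v f z) y)} ->
  'D_v (fun z => 'D_u f z) x = 'D_u (fun z => 'D_v f z) x.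
Proof.
move=> df du dv cvu cuv; apply: (eq_of_near_eq_values cvu cuv) => d d0.
(* a side for which the intermediate points are within [d] of [x] *)
pose s := d / (`|u| + `|v| + 1).
have D0 : 0 < `|u| + `|v| + 1 by rewrite ltr_wpDl// addr_ge0.
have s0 : 0 < s by rewrite divr_gt0.
have sd : s * (`|u| + `|v|) < d.
  by rewrite /s mulrAC ltr_pdivrMr// ltr_pM2l// ltrDl.
have [p px Ep] := second_difference v x s0 df du.
have [q qx Eq] := second_difference u x s0 df dv.
exists p, q; split; first exact: le_lt_trans px sd.
  by apply: le_lt_trans qx _; rewrite addrC.
apply: (@mulfI _ (s ^+ 2)); first by rewrite expf_neq0// gt_eqF.
rewrite -[LHS]Ep -[RHS]Eq [x + s *: u + _]addrAC; congr (_ + _).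
exact: addrAC.
Qed.

End Schwarz.

(** * Scalar functions of class C^k *)

Section ScalarCk.
Context {R : realType}.

(** The scalar counterpart of [Ck_on]: ring operations, and the entries of inverse
    matrices, are handled one scalar function at a time. *)
Fixpoint Ckf {m : nat} (k : nat) (O : set 'rV[R]_m) (f : 'rV[R]_m -> R) :
    Prop :=
  match k with
  | 0%N => forall x, O x -> {for x, continuous f}
  | k'.+1 => (forall x, O x -> differentiable f x) /\
             forall i, Ckf k' O (fun x => 'D_(delta_mx 0 i) f x)
  end.

Lemma Ckf_sub m k (O W : set 'rV[R]_m) f : O `<=` W -> Ckf k W f -> Ckf k O f.
Proof.
move=> OW; elim: k f => [|k IH] f /=; first by move=> fc x /OW; exact: fc.
by move=> [df Df]; split=> [x /OW|i]; [exact: df|exact: IH (Df i)].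
Qed.

Section Closure.
Context {m : nat} (O : set 'rV[R]_m) (oO : open O).
Implicit Types f g : 'rV[R]_m -> R.

(** Openness of [O] is what makes the iterated derivatives depend only on the
    values on [O]. *)
Lemma Ckf_eq k f g : (forall x, O x -> f x = g x) -> Ckf k O f -> Ckf k O g.
Proof.
have nearO (f' g' : 'rV[R]_m -> R) : (forall x, O x -> f' x = g' x) ->
    forall x, O x -> \forall y \near x, f' y = g' y.
  by move=> fg x Ox; apply: filterS fg _; exact: open_nbhs_nbhs.
elim: k f g => [|k IH] f g fg /=.
  move=> fc x Ox.
  have fcx : f y @[y --> x] --> g x by rewrite -fg//; exact: fc.
  by apply: cvg_trans fcx; exact: (near_eq_cvg (nearO _ _ fg x Ox)).
move=> [df Df]; split=> [x Ox|i].
  by apply: differentiable_near_eq (df x Ox); apply: nearO.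
by apply: IH (Df i) => x Ox; apply: near_eq_derive; apply: nearO.
Qed.

Lemma Ckf_pred k f : Ckf k.+1 O f -> Ckf k O f.
Proof.
elim: k f => [|k IH] f [df Df].
  by move=> x Ox; apply: differentiable_continuous; apply: df.
by split=> // i; apply: IH.
Qed.

Lemma Ckf_cst k (c : R) : Ckf k O (fun=> c).
Proof.
elim: k c => [|k IH] c /=; first by move=> x _; exact: cst_continuous.
split=> [x _|i]; first exact: differentiable_cst.
by apply: Ckf_eq (IH 0) => x _; rewrite derive_cst.
Qed.

Lemma Ckf_coord k j : Ckf k O (fun x => x 0 j).
Proof.
case: k => [|k] /=; first by move=> x _; exact: coord_continuous.
split=> [x _|i]; first exact: differentiable_coord.
apply: (Ckf_eq _ (Ckf_cst k ((delta_mx 0 i : 'rV[R]_m) 0 j))) => x _.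
rewrite -(@derive_coord _ _ _ id)//.
by rewrite derive_id.
Qed.

Lemma CkfD k f g : Ckf k O f -> Ckf k O g -> Ckf k O (fun x => f x + g x).
Proof.
elim: k f g => [|k IH] f g /=.
  by move=> fc gc x Ox; apply: continuousD; [exact: fc|exact: gc].
move=> [df Df] [dg Dg]; split=> [x Ox|i].
  by apply: differentiableD; [exact: df|exact: dg].
apply: Ckf_eq (IH _ _ (Df i) (Dg i)) => x Ox.
by rewrite -deriveD//; apply: diff_derivable; [exact: df|exact: dg].
Qed.

Lemma CkfM k f g : Ckf k O f -> Ckf k O g -> Ckf k O (fun x => f x * g x).
Proof.
elim: k f g => [|k IH] f g.
  by move=> fc gc x Ox; apply: continuousM; [exact: fc|exact: gc].
move=> fk gk; have [df Df] := fk; have [dg Dg] := gk; split=> [x Ox|i].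
  by apply: differentiableM; [exact: df|exact: dg].
apply: Ckf_eq (CkfD (IH _ _ (Ckf_pred fk) (Dg i)) (IH _ _ (Ckf_pred gk) (Df i))).
move=> x Ox.
by rewrite [RHS]deriveM//; apply: diff_derivable; [exact: df|exact: dg].
Qed.

Lemma CkfN k f : Ckf k O f -> Ckf k O (fun x => - f x).
Proof.
by move=> fk; apply: Ckf_eq (CkfM (Ckf_cst k (-1)) fk) => x _; rewrite mulN1r.
Qed.

Lemma CkfB k f g : Ckf k O f -> Ckf k O g -> Ckf k O (fun x => f x - g x).
Proof. by move=> fk /CkfN; apply: CkfD. Qed.

Lemma Ckf_sum k I (r : seq I) (P : pred I) (F : I -> 'rV[R]_m -> R) :
  (forall i, P i -> Ckf k O (F i)) ->
  Ckf k O (fun x => \sum_(i <- r | P i) F i x).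
Proof.
move=> Fk; elim: r => [|i r IH].
  by apply: Ckf_eq (Ckf_cst k 0) => x _; rewrite big_nil.
have [Pi|Pi] := boolP (P i).
  by apply: Ckf_eq (CkfD (Fk i Pi) IH) => x _; rewrite big_cons Pi.
by apply: Ckf_eq IH => x _; rewrite big_cons (negbTE Pi).
Qed.

Lemma Ckf_prod k I (r : seq I) (P : pred I) (F : I -> 'rV[R]_m -> R) :
  (forall i, P i -> Ckf k O (F i)) ->
  Ckf k O (fun x => \prod_(i <- r | P i) F i x).
Proof.
move=> Fk; elim: r => [|i r IH].
  by apply: Ckf_eq (Ckf_cst k 1) => x _; rewrite big_nil.
have [Pi|Pi] := boolP (P i).
  by apply: Ckf_eq (CkfM (Fk i Pi) IH) => x _; rewrite big_cons Pi.
by apply: Ckf_eq IH => x _; rewrite big_cons (negbTE Pi).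
Qed.

Lemma CkfV k f : (forall x, O x -> f x != 0) ->
  Ckf k O f -> Ckf k O (fun x => (f x)^-1).
Proof.
move=> f0; elim: k => [|k IH] fk.
  by move=> x Ox; apply: continuousV; [exact: f0|exact: fk].
have [df Df] := fk; split=> [x Ox|i].
  by apply: differentiableV; [exact: df|exact: f0].
have vk := IH (Ckf_pred fk).
apply: Ckf_eq (CkfN (CkfM (CkfM vk vk) (Df i))) => x Ox.
rewrite [RHS]deriveV//; [|exact: f0|by apply: diff_derivable; exact: df].
by rewrite -invfM -expr2 scaleNr.
Qed.

Lemma Ckf_det k q (A : 'rV[R]_m -> 'M[R]_q) :
  (forall i j, Ckf k O (fun x => A x i j)) -> Ckf k O (fun x => \det (A x)).
Proof.
move=> Ak; apply: Ckf_sum => s _; apply: CkfM; first exact: Ckf_cst.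
by apply: Ckf_prod.
Qed.

(** Cramer's rule: the entries of the inverse are rational in those of the matrix,
    with denominator the determinant. *)
Lemma Ckf_invmx k q (A : 'rV[R]_m -> 'M[R]_q) :
  (forall x, O x -> A x \in unitmx) ->
  (forall i j, Ckf k O (fun x => A x i j)) ->
  forall i j, Ckf k O (fun x => invmx (A x) i j).
Proof.
move=> Au Ak i j.
have Ck_adj : Ckf k O (fun x => \adj (A x) i j).
  apply: (@Ckf_eq _ (fun x => cofactor (A x) j i)).
    by move=> x _; rewrite mxE.
  apply: CkfM; first exact: Ckf_cst.
  apply: Ckf_det => a b.
  by apply: Ckf_eq (Ak (lift j a) (lift i b)) => x _; rewrite !mxE.
have Ck_invdet : Ckf k O (fun x => (\det (A x))^-1).
  apply: CkfV (Ckf_det Ak) => x /Au.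
  by rewrite unitmxE unitfE.
by apply: Ckf_eq (CkfM Ck_invdet Ck_adj) => x /Au Ax; rewrite /invmx Ax [RHS]mxE.
Qed.

End Closure.

Lemma Ckf_comp k m d (O : set 'rV[R]_m) (W : set 'rV[R]_d) (f : 'rV[R]_d -> R)
    (g : 'rV[R]_m -> 'rV[R]_d) : open O -> (forall x, O x -> W (g x)) ->
  Ckf k W f -> (forall j, Ckf k O (fun x => g x 0 j)) ->
  Ckf k O (fun x => f (g x)).
Proof.
move=> oO OW; elim: k f => [|k IH] f fk gk.
  move=> x Ox; apply: (@continuous_comp _ _ _ g f); last exact/fk/OW.
  by apply: continuous_row => j; exact: gk.
have [df Df] := fk.
have dg x : O x -> differentiable g x.
  by move=> Ox; apply/differentiable_coordP => j; apply: (proj1 (gk j)).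
split=> [x Ox|i].
  by apply: (@differentiable_comp _ _ _ _ g f); [exact: dg|exact/df/OW].
apply: (@Ckf_eq m O oO k (fun x => \sum_j 'D_(delta_mx 0 i) (fun y => g y 0 j) x
    * 'D_(delta_mx 0 j) f (g x))).
  by move=> x Ox; rewrite derive_chain//; [exact: dg|exact/df/OW].
apply: Ckf_sum => // j _; apply: CkfM => //; first exact: (proj2 (gk j)).
by apply: (IH _ (Df j)) => j'; apply: Ckf_pred.
Qed.

Lemma Ck_onP k m d (O : set 'rV[R]_m) (f : 'rV[R]_m -> 'rV[R]_d) : open O ->
  Ck_on k O f <-> forall j, Ckf k O (fun x => f x 0 j).
Proof.
move=> oO; elim: k f => [|k IH] f; split.
- move=> fc j x Ox; apply: (@continuous_comp _ _ _ f (fun M : 'rV[R]_d => M 0 j)).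
    exact: fc.
  exact: coord_continuous.
- by move=> fc x Ox; apply: continuous_row => j; exact: fc.
- move=> [df Df] j; split=> [x Ox|i].
    exact: (proj1 (differentiable_coordP _ _) (df x Ox) j).
  apply: Ckf_eq ((IH _).1 (Df i) j) => // x Ox.
  by rewrite /partial derive_coord//; apply: df.
- move=> fk; have df x : O x -> differentiable f x.
    by move=> Ox; apply/differentiable_coordP => j; apply: (proj1 (fk j)).
  split=> // i; apply/IH => j; apply: Ckf_eq (proj2 (fk j) i) => // x Ox.
  by rewrite /partial derive_coord//; apply: df.
Qed.

Lemma partial2_coord m d (O : set 'rV[R]_m)
    (f : 'rV[R]_m -> 'rV[R]_d) i j c x : open O -> O x -> smooth_on O f ->
  partial (partial f j) i x 0 c =
  'D_(delta_mx 0 i) (fun y => 'D_(delta_mx 0 j) (fun z => f z 0 c) y) x.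
Proof.
move=> oO Ox fs; rewrite /partial derive_coord; last exact: ((fs 2).2 j).1.
apply: near_eq_derive; apply: filterS (open_nbhs_nbhs (conj oO Ox)) => y Oy.
by rewrite derive_coord//; exact: (fs 1).1.
Qed.

Lemma frechet_criterion_row m (f : 'rV[R]_m -> R) (A : 'I_m -> R) (x : 'rV[R]_m) :
  (forall e, 0 < e -> \forall h \near (0 : 'rV[R]_m),
     `|f (h + x) - f x - \sum_i h 0 i * A i| <= e * `|h|) ->
  differentiable f x /\ forall i, 'D_(delta_mx 0 i) f x = A i.
Proof.
move=> fA; pose l (h : 'rV[R]_m) := \sum_i h 0 i * A i.
have l_lin : linear_for *%R l.
  move=> s u v; rewrite /l mulr_sumr -big_split/=; apply: eq_bigr => i _.
  by rewrite !mxE mulrDl mulrA.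
pose lM := GRing.isLinear.Build _ _ _ _ _ l_lin.
pose L : {linear 'rV[R]_m -> R} := HB.pack l lM.
have Lc : continuous L.
  have : Ckf 0 setT l.
    apply: (Ckf_sum openT) => i _.
    by apply: (CkfM openT); [exact: (Ckf_coord openT)|exact: (Ckf_cst openT)].
  by move=> lc h; exact: lc.
have [df dE] := frechet_criterion Lc fA.
split=> // i; rewrite deriveE// dE /= /l (bigD1 i)//= big1 => [|j ji].
  by rewrite mxE !eqxx mul1r addr0.
by rewrite mxE eqxx/= (negbTE ji) mul0r.
Qed.

End ScalarCk.

(** * Quadratic forms *)

Section QuadraticForms.
Context {R : realType}.

Lemma quadformE d (v : 'rV[R]_d) (A : 'M[R]_d) :
  (v *m A *m v^T) 0 0 = \sum_a \sum_b v 0 a * v 0 b * A a b.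
Proof.
rewrite exchange_big !mxE/=; apply: eq_bigr => b _; rewrite !mxE mulr_suml.
by apply: eq_bigr => a _; rewrite mulrAC.
Qed.

Lemma quadform_entries_le d (v : 'rV[R]_d) (A : 'M[R]_d) e :
  (forall a b, `|A a b| <= e) ->
  `|(v *m A *m v^T) 0 0| <= d%:R * e * sqnorm v.
Proof.
move=> Ae; rewrite quadformE.
apply: (@le_trans _ _ (\sum_a \sum_b e * (2^-1 * (v 0 a ^+ 2 + v 0 b ^+ 2)))).
  rewrite (le_trans (ler_norm_sum _ _ _))// ler_sum// => a _.
  rewrite (le_trans (ler_norm_sum _ _ _))// ler_sum// => b _.
  rewrite normrM mulrC; apply: ler_pM => //.
  rewrite ler_norml; apply/andP; split.
    have := sqr_ge0 (v 0 a + v 0 b); nra.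
  have := sqr_ge0 (v 0 a - v 0 b); nra.
have -> : \sum_a \sum_b e * (2^-1 * (v 0 a ^+ 2 + v 0 b ^+ 2)) =
   e * 2^-1 * \sum_(a < d) \sum_(b < d) (v 0 a ^+ 2 + v 0 b ^+ 2).
  rewrite mulr_sumr; apply: eq_bigr => a _; rewrite mulr_sumr.
  by apply: eq_bigr => b _; rewrite mulrA.
under eq_bigr do rewrite big_split/= sumr_const card_ord.
rewrite big_split/= sumr_const card_ord sumrMnl -/(sqnorm v).
rewrite -[sqnorm v *+ d]mulr_natl; move: (sqnorm v) (d%:R : R) => S D.
by have -> : e / 2 * (D * S + D * S) = D * e * S by field.
Qed.

Lemma coercive_unitmx d (A : 'M[R]_d) c : 0 < c ->
  (forall v : 'rV_d, c * sqnorm v <= (v *m A *m v^T) 0 0) -> A \in unitmx.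
Proof.
move=> c0 cA; rewrite -row_free_unit; apply: inj_row_free => v vA.
by apply: sqnorm_eq0; have := cA v; rewrite vA mul0mx mxE pmulr_rle0.
Qed.

End QuadraticForms.

(** * The Gram matrix of an immersion *)

Section Immersion.
Context {R : realType} {n r : nat} (phi : 'rV[R]_n -> 'rV[R]_r).
Hypothesis phi_smooth : smooth_on setT phi.

Lemma Ckf_phi k c : Ckf k setT (fun t => phi t 0 c).
Proof. by apply: (Ck_onP _ _ openT).1; exact: phi_smooth. Qed.

Lemma Ckf_d1 k a c : Ckf k setT (fun t => d1 phi t a c).
Proof.
by apply: (Ck_onP k (partial phi a) openT).1; exact: (phi_smooth k.+1).2.
Qed.

Lemma Ckf_d2 k a b c : Ckf k setT (fun t => d2 phi t a b c).
Proof.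
apply: (Ck_onP k (partial (partial phi b) a) openT).1.
exact: ((phi_smooth k.+2).2 b).2.
Qed.

Lemma differentiable_phi t : differentiable phi t.
Proof. exact: (phi_smooth 1).1. Qed.

Lemma differentiable_phi_coord c t : differentiable (fun t => phi t 0 c) t.
Proof. exact: (Ckf_phi 1 c).1. Qed.

Lemma differentiable_d1 a c t : differentiable (fun t => d1 phi t a c) t.
Proof. exact: (Ckf_d1 1 a c).1. Qed.

Lemma derive_phi_coord b c t :
  'D_(delta_mx 0 b) (fun t => phi t 0 c) t = d1 phi t b c.
Proof. by rewrite -derive_coord//; exact: differentiable_phi. Qed.

Lemma derive_d1 a b c t :
  'D_(delta_mx 0 b) (fun t => d1 phi t a c) t = d2 phi t b a c.
Proof.
rewrite -(@derive_coord _ _ _ (partial phi a))//.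
exact: ((phi_smooth 2).2 a).1.
Qed.

Lemma d2C a b c t : d2 phi t a b c = d2 phi t b a c.
Proof.
pose f (s : 'rV[R]_n) : R := phi s 0 c.
have d1E e : (fun z => d1 phi z e c) = (fun z => 'D_(delta_mx 0 e) f z).
  by apply/funext => z; rewrite derive_phi_coord.
have d2E e e' : d2 phi t e e' c =
    'D_(delta_mx 0 e) (fun z => 'D_(delta_mx 0 e') f z) t.
  by rewrite -derive_d1 d1E.
have f1 : forall y, differentiable f y by move=> y; exact: (Ckf_phi 1 c).1.
have f2 e y : differentiable (fun z => 'D_(delta_mx 0 e) f z) y.
  exact: ((Ckf_phi 2 c).2 e).1.
have f3 e e' : {for t, continuous
    (fun y => 'D_(delta_mx 0 e) (fun z => 'D_(delta_mx 0 e') f z) y)}.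
  exact: (((Ckf_phi 2 c).2 e').2 e).
rewrite (d2E a b) (d2E b a).
exact: (derive_commute f1 (f2 b) (f2 a) (f3 a b) (f3 b a)).
Qed.

Definition d1_mx (t : 'rV[R]_n) : 'M[R]_(n, r) := \matrix_(a, c) d1 phi t a c.

Lemma h_mxE t : h_mx phi t = d1_mx t *m (d1_mx t)^T.
Proof. by apply/matrixP => a b; rewrite !mxE; under [RHS]eq_bigr do rewrite !mxE. Qed.

Lemma h_mxC t a b : h_mx phi t a b = h_mx phi t b a.
Proof. by rewrite !mxE; apply: eq_bigr => c _; exact: mulrC. Qed.

Lemma Pi_mxE t : Pi_mx phi t = invmx (h_mx phi t) *m d1_mx t.
Proof.
by apply/matrixP => a b; rewrite !mxE; apply: eq_bigr => c _; rewrite !mxE mulrC.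
Qed.

Lemma mulmx_d1_mx t (v : 'rV[R]_n) : v *m d1_mx t = 'd phi t v.
Proof.
apply/rowP => c; rewrite -deriveE; last exact: differentiable_phi.
rewrite derive_coord; last exact: differentiable_phi.
rewrite derive_basis; last exact: differentiable_phi_coord.
by rewrite mxE; apply: eq_bigr => a _; rewrite mxE derive_phi_coord.
Qed.

Lemma quadform_gram t (v : 'rV[R]_n) :
  (v *m h_mx phi t *m v^T) 0 0 = sqnorm (v *m d1_mx t).
Proof.
rewrite h_mxE mulmxA -mulmxA -trmx_mul mxE.
by apply: eq_bigr => c _; rewrite [X in _ * X]mxE expr2.
Qed.

Hypothesis phi_immersion :
  forall x, injective ('d phi x : 'rV[R]_n -> 'rV[R]_r).

(** The quadratic form of [h] is the squared norm of the differential, so the kernel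
    of [h] is that of the differential. *)
Lemma gram_unit t : h_mx phi t \in unitmx.
Proof.
rewrite -row_free_unit; apply: inj_row_free => v vh.
apply: (phi_immersion (x := t)); rewrite linear0 -mulmx_d1_mx.
by apply: sqnorm_eq0; rewrite -quadform_gram vh mul0mx mxE.
Qed.

Lemma Pi_mx_d1 t : Pi_mx phi t *m (d1_mx t)^T = 1%:M.
Proof. by rewrite Pi_mxE -mulmxA -h_mxE mulVmx// gram_unit. Qed.

Lemma h_Pi_mx t : h_mx phi t *m Pi_mx phi t = d1_mx t.
Proof. by rewrite Pi_mxE mulmxA mulmxV ?mul1mx// gram_unit. Qed.

(** [Pi_mx] is a left inverse of the differential [v |-> v *m d1_mx t], so it
    bounds [v] by [v *m d1_mx t], whose squared norm is the quadratic form of [h].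
    This yields an explicit constant. *)
Lemma gram_coercive t : exists2 c, 0 < c &
  forall v : 'rV_n, c * sqnorm v <= (v *m h_mx phi t *m v^T) 0 0.
Proof.
pose K := 1 + \sum_a (\sum_c `|Pi_mx phi t a c|) ^+ 2.
have K0 : 0 < K by rewrite ltr_pwDl// sumr_ge0// => a _; exact: sqr_ge0.
exists K^-1; first by rewrite invr_gt0.
move=> v; rewrite ler_pdivrMl// quadform_gram.
set w := v *m d1_mx t.
have vE a : v 0 a = \sum_c w 0 c * Pi_mx phi t a c.
  have -> : v = w *m (Pi_mx phi t)^T.
    by rewrite /w -mulmxA -[d1_mx t]trmxK -trmx_mul Pi_mx_d1 trmx1 mulmx1.
  by rewrite mxE; apply: eq_bigr => c _; rewrite [X in _ * X]mxE.
have va a : v 0 a ^+ 2 <= (\sum_c `|Pi_mx phi t a c|) ^+ 2 * sqnorm w.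
  rewrite -[sqnorm w]sqr_sqrtr ?sqnorm_ge0// -exprMn -real_normK ?num_real//.
  rewrite ler_sqr ?nnegrE ?mulr_ge0 ?sqrtr_ge0 ?sumr_ge0//.
  rewrite vE mulr_suml (le_trans (ler_norm_sum _ _ _))// ler_sum// => c _.
  rewrite normrM mulrC ler_wpM2l// -sqrtr_sqr ler_wsqrtr//.
  exact: sqr_coord_le.
rewrite mulrDl mul1r mulr_suml ler_wpDl ?sqnorm_ge0//.
by apply: ler_sum => a _; exact: va.
Qed.

(** Both the first and the second derivative of a stationary parameter solve a
    system with matrix [h]; the part of the right-hand side that comes from a
    tangential projection is absorbed into [Pi_mx]. *)
Lemma gram_solve x (z : 'I_n -> R) (y : 'I_r -> R) (w : 'I_n -> R) :
  (forall a, \sum_b h_mx phi x a b * z b = \sum_c d1 phi x a c * y c + w a) ->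
  forall i, z i = \sum_c Pi_mx phi x i c * y c
                  + \sum_a invmx (h_mx phi x) i a * w a.
Proof.
move=> hz i; pose zv : 'cV[R]_n := \col_b z b.
have -> : z i = zv i 0 by rewrite mxE.
rewrite -[zv](mulKmx (gram_unit x)) [LHS]mxE.
have -> : \sum_c Pi_mx phi x i c * y c =
    \sum_a invmx (h_mx phi x) i a * \sum_c d1 phi x a c * y c.
  under [RHS]eq_bigr do rewrite mulr_sumr.
  rewrite exchange_big; apply: eq_bigr => c _; rewrite mxE mulr_suml.
  by apply: eq_bigr => a _; rewrite mulrA [d1 _ _ _ _ * _]mulrC.
rewrite -big_split; apply: eq_bigr => a _ /=.
rewrite -mulrDr -hz; congr (_ * _); rewrite [LHS]mxE.
by apply: eq_bigr => b _; rewrite [zv _ _]mxE.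
Qed.

End Immersion.

(** * The tangential residual and its monotonicity *)

Section Monotone.
Context {R : realType} {n r : nat} (phi : 'rV[R]_n -> 'rV[R]_r).
Hypothesis phi_smooth : smooth_on setT phi.

(** Minus half the partial derivative in [t] of the squared distance from [y] to
    [phi t]. *)
Definition tangential (y : 'rV[R]_r) (t : 'rV[R]_n) (a : 'I_n) : R :=
  \sum_(c < r) (y 0 c - phi t 0 c) * d1 phi t a c.

Definition half_hessian (y : 'rV[R]_r) (t : 'rV[R]_n) : 'M[R]_n :=
  \matrix_(a, b) (h_mx phi t a b
                  - \sum_(c < r) (y 0 c - phi t 0 c) * d2 phi t b a c).

Lemma half_hessian_phi t : half_hessian (phi t) t = h_mx phi t.
Proof.
apply/matrixP => a b; rewrite mxE big1 ?subr0// => c _.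
by rewrite subrr mul0r.
Qed.

Lemma tangential_shift y k t a :
  tangential (k + y) t a =
  tangential y t a + \sum_j k 0 j * d1 phi t a j.
Proof.
rewrite -big_split/=; apply: eq_bigr => j _.
by rewrite mxE; ring.
Qed.

Lemma differentiable_tangential y a t :
  differentiable (fun s => tangential y s a) t.
Proof.
have -> : (fun s => tangential y s a) =
    \sum_(c < r) (fun s => (y 0 c - phi s 0 c) * d1 phi s a c).
  by apply/funext => s; rewrite fct_sumE.
apply: differentiable_sum => c; apply: differentiableM.
  by apply: differentiableB => //; exact: differentiable_phi_coord.
exact: differentiable_d1.
Qed.

Lemma derive_tangential y a b t :
  'D_(delta_mx 0 b) (fun s => tangential y s a) t = - half_hessian y t a b.
Proof.
have dphi c := differentiable_phi_coord phi_smooth c t.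
have dd1 c := differentiable_d1 phi_smooth a c t.
have -> : (fun s => tangential y s a) =
    \sum_(c < r) (fun s => (y 0 c - phi s 0 c) * d1 phi s a c).
  by apply/funext => s; rewrite fct_sumE.
have dB c : derivable (fun s => y 0 c - phi s 0 c) t (delta_mx 0 b).
  by apply: derivableB => //; exact: diff_derivable.
have DB c : 'D_(delta_mx 0 b) (fun s => y 0 c - phi s 0 c) t = - d1 phi t b c.
  rewrite [LHS]deriveB//; last exact: diff_derivable.
  by rewrite derive_cst sub0r derive_phi_coord.
rewrite derive_sum; last first.
  by move=> c; apply: derivableM => //; exact: diff_derivable.
rewrite 2!mxE opprB -sumrB; apply: eq_bigr => c _.
rewrite [LHS]deriveM//; last exact: diff_derivable.
by rewrite DB derive_d1// /GRing.scale/= mulrN.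
Qed.

Lemma derive_tangentialE y a v t :
  'D_v (fun s => tangential y s a) t = - \sum_b half_hessian y t a b * v 0 b.
Proof.
rewrite derive_basis; last exact: differentiable_tangential.
rewrite -sumrN; apply: eq_bigr => b _.
by rewrite derive_tangential mulrN mulrC.
Qed.

(** The pair [(y, t)] is encoded as one row vector, so that joint smoothness is an
    instance of [Ckf]. *)
Lemma Ckf_half_hessian k a b :
  Ckf k setT (fun z : 'rV[R]_(r + n) =>
    half_hessian (lsubmx z) (rsubmx z) a b).
Proof.
pose rs (z : 'rV[R]_(r + n)) : 'rV[R]_n := rsubmx z.
have Ckf_rs (f : 'rV[R]_n -> R) : Ckf k setT f -> Ckf k setT (fun z => f (rs z)).
  move=> fk; apply: (@Ckf_comp _ _ _ _ setT setT f rs) => // [|j]; first exact: openT.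
  by apply: (Ckf_eq openT _ (Ckf_coord openT k (rshift r j))) => z _; rewrite mxE.
apply: (@Ckf_eq _ _ _ openT _ (fun z =>
  \sum_(c < r) d1 phi (rs z) a c * d1 phi (rs z) b c
  - \sum_(c < r) (z 0 (lshift n c) - phi (rs z) 0 c) * d2 phi (rs z) b a c)).
  move=> z _; rewrite !mxE; congr (_ - _).
  by apply: eq_bigr => c _; rewrite mxE.
have oT := @openT 'rV[R]_(r + n).
apply: CkfB => //; apply: Ckf_sum => // c _; apply: CkfM => //.
- by apply: (Ckf_rs (fun t => d1 phi t a c)); exact: Ckf_d1.
- by apply: (Ckf_rs (fun t => d1 phi t b c)); exact: Ckf_d1.
- apply: CkfB => //; first exact: Ckf_coord.
  by apply: (Ckf_rs (fun t => phi t 0 c)); exact: Ckf_phi.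
- by apply: (Ckf_rs (fun t => d2 phi t b a c)); exact: Ckf_d2.
Qed.

Hypothesis phi_immersion :
  forall x, injective ('d phi x : 'rV[R]_n -> 'rV[R]_r).

(** At [(phi x, x)] the matrix is [h_mx phi x], which is coercive; coercivity with
    half the constant survives a small perturbation of the entries. *)
Lemma half_hessian_coercive x : exists c d, [/\ 0 < c, 0 < d &
  forall y t, ball (phi x) d y -> ball x d t ->
  forall v : 'rV_n, c * sqnorm v <= (v *m half_hessian y t *m v^T) 0 0].
Proof.
have [c c0 hc] := gram_coercive phi_smooth phi_immersion x.
(* [n * e <= c / 2]; the successor avoids a division by 0 when [n = 0] *)
pose e := c / 2 / n.+1%:R.
have e0 : 0 < e by rewrite !divr_gt0.
pose F a b (z : 'rV[R]_(r + n)) := half_hessian (lsubmx z) (rsubmx z) a b.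
pose z0 : 'rV[R]_(r + n) := row_mx (phi x) x.
have nF : \forall z \near z0, forall a b, `|F a b z0 - F a b z| <= e.
  by apply: near_entries => // a b; exact: (Ckf_half_hessian 0 a b).
have [d /= d0 {}nF] := (nbhs_ballP _ _).1 nF.
exists (c / 2), d; split=> //; first exact: divr_gt0.
move=> y t [_ yd] [_ td] v.
have /nF : ball z0 d (row_mx y t).
  split=> // i j; rewrite /z0 !mxE; case: (fintype.split j) => k; rewrite ?ord1.
    exact: yd.
  exact: td.
rewrite /F /z0 !row_mxKl !row_mxKr half_hessian_phi => hM.
have hB : (v *m h_mx phi x *m v^T) 0 0 - (v *m half_hessian y t *m v^T) 0 0
    <= n%:R * e * sqnorm v.
  have : `|(v *m (h_mx phi x - half_hessian y t) *m v^T) 0 0|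
      <= n%:R * e * sqnorm v.
    by apply: quadform_entries_le => a b; rewrite mxE [X in _ + X]mxE; exact: hM.
  rewrite mulmxBr mulmxBl mxE [X in _ + X]mxE; apply: le_trans.
  exact: ler_norm.
have le2 : n%:R * e * sqnorm v <= c / 2 * sqnorm v.
  rewrite ler_wpM2r ?sqnorm_ge0// /e mulrCA ger_pMr ?divr_gt0//.
  by rewrite ler_pdivrMr// mul1r ler_nat.
have := hc v; lra.
Qed.

(** The Jacobian of the residual is minus [half_hessian], so by the mean value
    theorem along the segment from [s] to [t] coercivity becomes strong
    monotonicity.  The common radius [d] also serves for the invertibility of
    [half_hessian]. *)
Lemma tangential_monotone x : exists c d, [/\ 0 < c, 0 < d &
  (forall y t, ball (phi x) d y -> ball x d t ->
    half_hessian y t \in unitmx) /\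
  forall y s t, ball (phi x) d y -> ball x d s -> ball x d t ->
    \sum_a (t - s) 0 a * (tangential y t a - tangential y s a)
    <= - (c * sqnorm (t - s))].
Proof.
have [c [d [c0 d0 cM]]] := half_hessian_coercive x.
exists c, d; split=> //; split=> [y t yd td|y s t yd sd td].
  exact: (coercive_unitmx c0 (cM y t yd td)).
set v := t - s.
pose f p := \sum_a v 0 a * tangential y p a.
have fE : f = \sum_a (fun p => v 0 a * tangential y p a).
  by apply/funext => p; rewrite fct_sumE.
have dva a p : differentiable (fun p => v 0 a * tangential y p a) p.
  by apply: differentiableM => //; exact: differentiable_tangential.
have df p : differentiable f p.
  by rewrite fE; apply: differentiable_sum.
have [th /andP[th0 th1]] :=
  @mean_value_line _ _ f s v 1 ltr01 (fun th _ => df _).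
rewrite scale1r mul1r [s + v]addrC subrK.
have -> : f t - f s = \sum_a v 0 a * (tangential y t a - tangential y s a).
  by rewrite -sumrB; apply: eq_bigr => a _; rewrite mulrBr.
move=> ->; rewrite fE derive_sum; last first.
  by move=> a; exact: diff_derivable.
set p := s + th *: v.
have pd : ball x d p by apply: ball_convex => //; rewrite !ltW.
have -> : \sum_a 'D_v (fun p => v 0 a * tangential y p a) p =
    - (v *m half_hessian y p *m v^T) 0 0.
  rewrite quadformE -sumrN; apply: eq_bigr => a _.
  rewrite [LHS]deriveMl; last exact/diff_derivable/differentiable_tangential.
  rewrite derive_tangentialE mulrN mulr_sumr; congr (- _).
  by apply: eq_bigr => b _; rewrite -mulrA; congr (_ * _); exact: mulrC.
by rewrite lerN2; apply: cM.
Qed.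

End Monotone.

(** * Nearest points of an embedded submanifold *)

Section NearestPoint.
Context {R : realType} {n r : nat} (phi : 'rV[R]_n -> 'rV[R]_r).
Hypothesis phi_smooth : smooth_on setT phi.

(** Fermat's rule for the squared distance in the interior of the parameter domain. *)
Lemma nearest_stationary (U : set 'rV[R]_n) y t : open U -> U t ->
  (forall s, U s -> sqnorm (y - phi t) <= sqnorm (y - phi s)) ->
  forall a, tangential phi y t a = 0.
Proof.
move=> oU Ut tmin a.
pose g c (s : 'rV[R]_n) : R := y 0 c - phi s 0 c.
have dg c s : differentiable (g c) s.
  by apply: differentiableB => //; exact: differentiable_phi_coord.
have Dg c : 'D_(delta_mx 0 a) (g c) t = - d1 phi t a c.
  rewrite [LHS]deriveB//.
    by rewrite derive_cst sub0r derive_phi_coord.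
  exact/diff_derivable/differentiable_phi_coord.
have fE : (fun s => sqnorm (y - phi s)) = \sum_(c < r) (g c * g c).
  apply/funext => s; rewrite fct_sumE; apply: eq_bigr => c _.
  by rewrite !mxE expr2.
have dgg c s : differentiable (g c * g c) s by exact: differentiableM.
have df s : differentiable (fun s => sqnorm (y - phi s)) s.
  by rewrite fE; apply: differentiable_sum.
have := local_min_derive (delta_mx 0 a) oU Ut df tmin.
rewrite fE derive_sum; last by move=> c; exact: diff_derivable.
have -> : \sum_(c < r) 'D_(delta_mx 0 a) (g c * g c) t =
    - (2 * tangential phi y t a).
  rewrite /tangential mulr_sumr -sumrN; apply: eq_bigr => c _.
  rewrite deriveM; [|exact: diff_derivable..].
  by rewrite Dg /GRing.scale/= /g; ring.
by move/eqP; rewrite oppr_eq0 mulf_eq0 pnatr_eq0/= => /eqP.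
Qed.

End NearestPoint.

Section Projection.
Context {R : realType} {n r : nat} (phi : 'rV[R]_n -> 'rV[R]_r).
Hypothesis phi_embedding : smooth_embedding phi.

Lemma pinv_phi t : pinv setT phi (phi t) = t.
Proof.
case: phi_embedding => _ phi_inj _ _.
by apply: pinvKV; rewrite ?inE// => s s' _ _; exact: phi_inj.
Qed.

Lemma pinv_continuous x d : 0 < d -> exists2 e, 0 < e &
  forall t, `|phi x - phi t| < e -> ball x d t.
Proof.
move=> d0; case: phi_embedding => _ _ _ /subspace_continuousP pc.
have pcx : pinv setT phi @ within (range phi) (nbhs (phi x)) --> x.
  rewrite -[X in _ --> X]pinv_phi; apply: pc.
  by exists x.
have /nbhs_ballP[e /= e0 he] := pcx (ball x d) (nbhsx_ballx _ _ d0).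
exists e => // t xt; have := he (phi t).
rewrite -ball_normE/= => /(_ xt) /(_ (ex_intro2 _ _ t I erefl)) /=.
by rewrite pinv_phi -ball_normE.
Qed.

(** The point [phi t] is within twice the distance from [y] to [phi x] of [phi x],
    hence close to it, and the inverse of an embedding is continuous.  This is where
    [phi] has to be an embedding and not only an injective immersion. *)
Lemma closer_point_near x d : 0 < d -> exists2 e, 0 < e &
  forall y t, ball (phi x) e y ->
    sqnorm (y - phi t) <= sqnorm (y - phi x) -> ball x d t.
Proof.
move=> d0; have [e e0 he] := pinv_continuous x d0.
(* [r.+1] to bound [y - phi t] by [y - phi x] in the sup norm, plus 1 for the
   triangle inequality *)
exists (e / r.+2%:R); first exact: divr_gt0.
move=> y t; rewrite -ball_normE/= distrC => xy yt; apply: he.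
have -> : phi x - phi t = (phi x - y) + (y - phi t) by rewrite addrA subrK.
rewrite (le_lt_trans (ler_normD _ _))// distrC.
apply: le_lt_trans (lerD (lexx _) (norm_le_of_sqnorm yt)) _.
by rewrite -[X in X + _]mul1r -mulrDl addrC natr1 mulrC -ltr_pdivlMr.
Qed.

(** A minimiser over the closed ball lies in the open ball by [closer_point_near],
    hence is stationary; two stationary parameters in the ball agree by
    monotonicity, which makes the minimum strict. *)
Lemma metric_projection_exists x : exists Pis, metric_projection_near phi x Pis.
Proof.
have [phi_smooth _ phi_immersion _] := phi_embedding.
have [c [d [c0 d0 [_ mono]]]] := tangential_monotone phi_smooth phi_immersion x.
have [e e0 he] := closer_point_near x d0.
pose U : set 'rV[R]_n := ball x d.
pose m := Num.min d e.
have m0 : 0 < m by rewrite lt_min d0 e0.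
pose V : set 'rV[R]_r := ball (phi x) m.
have Vd y : V y -> ball (phi x) d y by apply: le_ball; rewrite ge_min lexx.
have Ve y : V y -> ball (phi x) e y by apply: le_ball; rewrite ge_min lexx orbT.
exists (fun y => xget 0 (nearest_point (phi @` U) y)), U, V; split.
- by split; [exact: ball_open|exact: ballxx].
- by split; [exact: ball_open|exact: ballxx].
move=> y Vy; apply: xgetPex.
pose K := closed_ball x d.
have Kc : compact K.
  apply: bounded_closed_compact; last exact: closed_ball_closed.
  exists (`|x| + d); split; first exact: num_real.
  move=> M xM t; rewrite /K closed_ballE// /closed_ball_/= => xt.
  rewrite (le_trans _ (ltW xM))// -[t](subKr x) (le_trans (ler_normB _ _))//.
  by rewrite lerD2l.
have fc : {within K, continuous (fun t => sqnorm (y - phi t))}.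
  apply: continuous_subspaceT => t.
  have -> : (fun t => sqnorm (y - phi t)) =
      (fun t => \sum_(c < r) (y 0 c - phi t 0 c) * (y 0 c - phi t 0 c)).
    by apply/funext => s; apply: eq_bigr => i _; rewrite !mxE expr2.
  have Cg i : Ckf 0 setT (fun t => y 0 i - phi t 0 i).
    by apply: CkfB; [exact: openT|exact: Ckf_cst openT _ _|exact: Ckf_phi].
  suff : Ckf 0 setT (fun t => \sum_(c < r) (y 0 c - phi t 0 c) * (y 0 c - phi t 0 c)).
    by apply.
  by apply: Ckf_sum => [|i _]; [exact: openT|apply: CkfM => //; exact: openT].
have [|t _ tmin] := compact_EVT_min _ Kc fc.
  by exists x; exact: closed_ballxx.
have tminU s : U s -> sqnorm (y - phi t) <= sqnorm (y - phi s).
  by move=> Us; apply: tmin; rewrite inE; exact: subset_closed_ball.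
have Ux : U x by exact: ballxx.
have Ut : U t by apply: he (Ve _ Vy) _; exact: tminU.
exists (phi t); split; first by exists t.
move=> _ [s Us <-] st; rewrite ltNge euclidean_dist_le; apply/negP => sle.
apply: st; congr phi; apply/eqP; rewrite -subr_eq0; apply/eqP/sqnorm_eq0.
have sminU s' : U s' -> sqnorm (y - phi s) <= sqnorm (y - phi s').
  by move=> Us'; exact: le_trans sle (tminU _ Us').
have := mono y t s (Vd _ Vy) Ut Us.
rewrite big1 => [|a _]; last first.
  rewrite (nearest_stationary phi_smooth (ball_open _ _) Ut tminU).
  by rewrite (nearest_stationary phi_smooth (ball_open _ _) Us sminU) subrr mulr0.
by rewrite lerNr oppr0 pmulr_rle0.
Qed.

(** The parameter domain of [Pis] may be large, but [Pis y] is at least as close to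
    [y] as [phi x] is, which forces its parameter to be near [x]; that parameter is
    stationary because it minimises over an open set. *)
Lemma metric_projection_stationary x Pis : metric_projection_near phi x Pis ->
  forall d, 0 < d -> exists2 e, 0 < e & forall y, ball (phi x) e y ->
  exists t, [/\ Pis y = phi t, ball x d t & forall a, tangential phi y t a = 0].
Proof.
have [phi_smooth _ _ _] := phi_embedding.
move=> [U [V [[oU Ux] [oV Vx] near_pt]]] d d0.
have [e e0 he] := closer_point_near x d0.
have [e' /= e'0 VV] := (nbhs_ballP _ _).1 (open_nbhs_nbhs (conj oV Vx)).
exists (Num.min e e'); first by rewrite lt_min e0.
move=> y xy.
have ye : ball (phi x) e y by apply: le_ball xy; rewrite ge_min lexx.
have Vy : V y by apply/VV/(le_ball _ xy); rewrite ge_min lexx orbT.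
have [[t Ut tE] tlt] := near_pt y Vy.
have tmin s : U s -> sqnorm (y - phi t) <= sqnorm (y - phi s).
  move=> Us; rewrite -euclidean_dist_le tE.
  have [->//|neq] := pselect (phi s = Pis y).
  by apply/ltW/tlt => //; exists s.
exists t; split=> //; first exact: he (tmin _ Ux).
exact: (nearest_stationary phi_smooth oU Ut tmin).
Qed.

End Projection.

(** * Smooth dependence of the stationary parameter *)

Section StationaryParameter.
Context {R : realType} {n r : nat} (phi : 'rV[R]_n -> 'rV[R]_r).
Hypothesis phi_smooth : smooth_on setT phi.
Variables (V : set 'rV[R]_r) (B : set 'rV[R]_n) (tau : 'rV[R]_r -> 'rV[R]_n).
Variable c : R.
Hypotheses (V_open : open V) (c_gt0 : 0 < c).
Hypothesis tauB : forall y, V y -> B (tau y).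
Hypothesis tau_tangential : forall y, V y -> forall a, tangential phi y (tau y) a = 0.
Hypothesis unit_hessian :
  forall y t, V y -> B t -> half_hessian phi y t \in unitmx.
Hypothesis monotone : forall y s t, V y -> B s -> B t ->
  \sum_a (t - s) 0 a * (tangential phi y t a - tangential phi y s a)
    <= - (c * sqnorm (t - s)).

(** Monotonicity at the point [k + y], applied to its stationary parameter and to
    that of [y]: the residual at the former vanishes, and at the latter it is
    linear in [k]. *)
Lemma stationary_lipschitz y : V y -> exists2 L, 0 <= L &
  forall k, V (k + y) -> `|tau (k + y) - tau y| <= L * `|k|.
Proof.
move=> Vy; pose C := \sum_a \sum_j `|d1 phi (tau y) a j|.
have C0 : 0 <= C by apply: sumr_ge0 => a _; apply: sumr_ge0.
exists (C / c) => [|k Vk]; first exact: divr_ge0 C0 (ltW c_gt0).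
set dl := tau (k + y) - tau y.
have [->|dl0] := eqVneq `|dl| 0.
  by rewrite mulr_ge0// divr_ge0// ltW.
have := monotone Vk (tauB Vy) (tauB Vk); rewrite -/dl.
under eq_bigr => a _.
  rewrite (tau_tangential Vk) tangential_shift (tau_tangential Vy) !add0r.
  over.
have -> : \sum_a dl 0 a * - (\sum_j k 0 j * d1 phi (tau y) a j) =
    - \sum_a \sum_j dl 0 a * (k 0 j * d1 phi (tau y) a j).
  by rewrite -sumrN; apply: eq_bigr => a _; rewrite mulrN mulr_sumr.
rewrite lerN2 => le1.
have le2 : \sum_a \sum_j dl 0 a * (k 0 j * d1 phi (tau y) a j)
    <= `|dl| * `|k| * C.
  rewrite /C mulr_sumr; apply: ler_sum => a _.
  rewrite mulr_sumr; apply: ler_sum => j _.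
  rewrite (le_trans (ler_norm _))// !normrM -mulrA.
  by rewrite !ler_pM ?mulr_ge0// ?norm_coord_le.
have dl_gt0 : 0 < `|dl| by rewrite lt_def dl0/=.
have le3 : c * `|dl| ^+ 2 <= `|dl| * `|k| * C.
  apply: (@le_trans _ _ (c * sqnorm dl)).
    by rewrite ler_pM2l// norm_sqr_le.
  exact: le_trans le1 le2.
rewrite mulrAC ler_pdivlMr// -(ler_pM2l dl_gt0).
have -> : `|dl| * (`|dl| * c) = c * `|dl| ^+ 2 by ring.
by have -> : `|dl| * (C * `|k|) = `|dl| * `|k| * C by ring.
Qed.

(** The derivative predicted by the implicit function theorem.  Writing [dl] for the
    increment of [tau], the vector [M dl] differs from the linear expression in
    [k] by a remainder [Rem] of order [o(dl) + o(1) k]; by the Lipschitz bound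
    this is [o(k)], and applying the inverse of [M] gives the claim. *)
Lemma stationary_derive y b : V y ->
  differentiable (fun z => tau z 0 b) y /\
  forall i, 'D_(delta_mx 0 i) (fun z => tau z 0 b) y =
    \sum_a invmx (half_hessian phi y (tau y)) b a * d1 phi (tau y) a i.
Proof.
move=> Vy; set t := tau y; set M := half_hessian phi y t; set N := invmx M.
have Mu : M \in unitmx by apply: unit_hessian => //; exact: tauB.
have [L L0 Ltau] := stationary_lipschitz Vy.
apply: frechet_criterion_row => e e0.
pose S := \sum_a `|N b a|.
have S0 : 0 <= S by apply: sumr_ge0.
(* chosen so that [S * (eta * (L + r))] is at most [e] *)
pose eta := e / ((S + 1) * (L + r%:R + 1)).
have D0 : 0 < (S + 1) * (L + r%:R + 1).
  by rewrite mulr_gt0 ?ltr_wpDl// addr_ge0.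
have eta0 : 0 < eta by exact: divr_gt0.
have nJ : \forall s \near t, forall a j, `|d1 phi t a j - d1 phi s a j| <= eta.
  by apply: near_entries => // a j; exact: (Ckf_d1 phi_smooth 0 a j).
have nG a : \forall h \near (0 : 'rV[R]_n),
    `|tangential phi y (h + t) a + \sum_b' M a b' * h 0 b'| <= eta * `|h|.
  have dG := differentiable_tangential phi_smooth y a t.
  have /eqaddoP/(_ eta eta0) := diff_locally dG.
  apply: filterS => h; rewrite /cst !fctE/= (tau_tangential Vy) add0r.
  by rewrite -deriveE// derive_tangentialE// opprK.
have {}nG : \forall h \near (0 : 'rV[R]_n), forall a,
    `|tangential phi y (h + t) a + \sum_b' M a b' * h 0 b'| <= eta * `|h|.
  by apply: near_forall.
have [dJ /= dJ0 {}nJ] := (nbhs_ballP _ _).1 nJ.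
have [dG /= dG0 {}nG] := (nbhs_ballP _ _).1 nG.
have [dV /= dV0 VV] := (nbhs_ballP _ _).1 (open_nbhs_nbhs (conj V_open Vy)).
apply/nbhs_ballP; exists (Num.min dV (Num.min dJ dG / (L + 1))) => /=.
  by rewrite lt_min dV0 divr_gt0 ?ltr_wpDl// lt_min dJ0.
move=> k; rewrite -ball_normE/= sub0r normrN lt_min => /andP[kV].
have L1 : 0 < L + 1 by rewrite ltr_wpDl.
rewrite ltr_pdivlMr// => kd.
have Vk : V (k + y).
  by apply: VV; rewrite -ball_normE/= opprD addrCA subrr addr0 normrN.
set dl := tau (k + y) - t.
have tdl : tau (k + y) = dl + t by rewrite subrK.
have dlL : `|dl| <= L * `|k| by exact: Ltau.
have : `|dl| < Num.min dJ dG.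
  apply: le_lt_trans dlL (le_lt_trans _ kd).
  by rewrite mulrC ler_wpM2l// lerDl.
rewrite lt_min => /andP[dldJ dldG].
have {}nJ a j : `|d1 phi (dl + t) a j - d1 phi t a j| <= eta.
  rewrite distrC; apply: nJ.
  by rewrite -ball_normE/= opprD addrCA subrr addr0 normrN.
have {}nG a : `|tangential phi y (dl + t) a + \sum_b' M a b' * dl 0 b'|
    <= eta * `|dl|.
  by apply: nG; rewrite -ball_normE/= sub0r normrN.
pose Rem a := \sum_b' M a b' * dl 0 b' - \sum_j k 0 j * d1 phi t a j.
have RemE a : Rem a =
    (tangential phi y (dl + t) a + \sum_b' M a b' * dl 0 b')
    + \sum_j k 0 j * (d1 phi (dl + t) a j - d1 phi t a j).
  have := tau_tangential Vk a; rewrite tdl tangential_shift => /eqP.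
  rewrite addr_eq0 => /eqP ->.
  have -> : \sum_j k 0 j * (d1 phi (dl + t) a j - d1 phi t a j) =
      \sum_j k 0 j * d1 phi (dl + t) a j - \sum_j k 0 j * d1 phi t a j.
    by rewrite -sumrB; apply: eq_bigr => j _; rewrite mulrBr.
  by rewrite /Rem [- _ + _]addrC addrA subrK.
have RemB a : `|Rem a| <= eta * (L + r%:R) * `|k|.
  rewrite RemE (le_trans (ler_normD _ _))// mulrDr mulrDl lerD//.
    by rewrite (le_trans (nG a))// -mulrA ler_wpM2l// ltW.
  rewrite (le_trans (ler_norm_sum _ _ _))//.
  apply: (@le_trans _ _ (\sum_(j < r) `|k| * eta)).
    by apply: ler_sum => j _; rewrite normrM ler_pM// norm_coord_le.
  rewrite sumr_const card_ord -[leLHS]mulr_natl le_eqVlt.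
  by apply/orP; left; apply/eqP; ring.
have mainE : tau (k + y) 0 b - t 0 b
    - \sum_i k 0 i * (\sum_a N b a * d1 phi t a i) = \sum_a N b a * Rem a.
  have -> : tau (k + y) 0 b - t 0 b = \sum_a N b a * \sum_b' M a b' * dl 0 b'.
    have -> : tau (k + y) 0 b - t 0 b = (dl^T) b 0 by rewrite !mxE.
    rewrite -[dl^T](mulKmx Mu) mxE; apply: eq_bigr => a _.
    rewrite [(_ *m _) a 0]mxE; congr (_ * _).
    by apply: eq_bigr => b' _; rewrite [dl^T _ _]mxE.
  under [X in _ - X]eq_bigr do rewrite mulr_sumr.
  rewrite exchange_big/= -sumrB; apply: eq_bigr => a _.
  rewrite /Rem mulrBr; congr (_ - _); rewrite mulr_sumr.
  by apply: eq_bigr => j _; rewrite mulrCA.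
rewrite mainE (le_trans (ler_norm_sum _ _ _))//.
apply: (@le_trans _ _ (\sum_a `|N b a| * (eta * (L + r%:R) * `|k|))).
  by apply: ler_sum => a _; rewrite normrM ler_wpM2l.
rewrite -mulr_suml -/S mulrA ler_wpM2r//.
have -> : S * (eta * (L + r%:R)) =
    e * (S * (L + r%:R)) / ((S + 1) * (L + r%:R + 1)) by rewrite /eta; ring.
rewrite ler_pdivrMr// ler_pM2l//.
by rewrite ler_pM ?addr_ge0// lerDl.
Qed.

(** Bootstrap: the partial derivatives of [tau] are rational functions of [phi] and
    its derivatives at [(y, tau y)], so they are as regular as [tau] itself. *)
Lemma stationary_Ck k b : Ckf k V (fun y => tau y 0 b).
Proof.
elim: k b => [|k IH] b.
  by move=> y Vy; apply: differentiable_continuous; exact: (stationary_derive b Vy).1.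
split=> [y Vy|i]; first exact: (stationary_derive b Vy).1.
apply: (@Ckf_eq _ _ _ V_open _ (fun y =>
    \sum_a invmx (half_hessian phi y (tau y)) b a * d1 phi (tau y) a i)).
  by move=> y Vy; rewrite (stationary_derive b Vy).2.
apply: Ckf_sum => // a _; apply: CkfM => //; last first.
  by apply: (Ckf_comp V_open (fun _ _ => I) (Ckf_d1 phi_smooth k a i) IH).
apply: Ckf_invmx => // [y Vy|p q]; first by apply: unit_hessian => //; exact: tauB.
pose z y : 'rV[R]_(r + n) := row_mx y (tau y).
have zk j : Ckf k V (fun y => z y 0 j).
  rewrite -(splitK j); case: (fintype.split j) => j'.
    by apply: Ckf_eq (Ckf_coord V_open k j') => // y _; rewrite row_mxEl.
  by apply: Ckf_eq (IH j') => // y _; rewrite row_mxEr.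
have zM := @Ckf_comp _ k _ _ V setT
  (fun w : 'rV[R]_(r + n) => half_hessian phi (lsubmx w) (rsubmx w) p q) z
  V_open (fun _ _ => I) (Ckf_half_hessian phi_smooth k p q) zk.
apply: (Ckf_eq V_open _ zM) => y _.
by rewrite /z row_mxKl row_mxKr.
Qed.

End StationaryParameter.

(** The values of [Pis] near [phi x] are stationary points with parameters in the
    ball of monotonicity, so the smooth dependence above applies to them.  At
    [phi x] itself [x] is stationary, hence is the parameter. *)
Lemma metric_projection_smooth {R : realType} {n r : nat} (phi : 'rV[R]_n -> 'rV[R]_r)
    x Pis : smooth_embedding phi -> metric_projection_near phi x Pis ->
  exists V : set 'rV[R]_r, [/\ open V, V (phi x),
    forall s b, Ckf s V (fun y => (pinv setT phi \o Pis) y 0 b),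
    (pinv setT phi \o Pis) (phi x) = x &
    forall y, V y -> forall a,
      tangential phi y ((pinv setT phi \o Pis) y) a = 0].
Proof.
move=> phi_emb Pis_near; have [phi_smooth _ phi_imm _] := phi_emb.
have [c [d [c0 d0 [Mu mono]]]] := tangential_monotone phi_smooth phi_imm x.
have [e e0 Pis_e] := metric_projection_stationary phi_emb Pis_near d0.
pose V : set 'rV[R]_r := ball (phi x) (Num.min d e).
have m0 : 0 < Num.min d e by rewrite lt_min d0 e0.
have Vx : V (phi x) by exact: ballxx.
have oV : open V by exact: ball_open.
have Vd y : V y -> ball (phi x) d y by apply: le_ball; rewrite ge_min lexx.
have Ve y : V y -> ball (phi x) e y by apply: le_ball; rewrite ge_min lexx orbT.
set tau := pinv setT phi \o Pis.
have tauP y : V y -> ball x d (tau y) /\ forall a, tangential phi y (tau y) a = 0.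
  move=> Vy; have [t [tE td ty]] := Pis_e y (Ve _ Vy).
  by rewrite /tau /= tE pinv_phi.
exists V; split=> //.
- move=> s b; apply: (@stationary_Ck _ _ _ phi phi_smooth V (ball x d) tau c) => //.
  + by move=> y Vy; exact: (tauP y Vy).1.
  + by move=> y Vy; exact: (tauP y Vy).2.
  + by move=> y t Vy td; apply: Mu => //; exact: Vd.
  + by move=> y s' t Vy; apply: mono; exact: Vd.
- apply/eqP; rewrite -subr_eq0; apply/eqP/sqnorm_eq0.
  have := mono (phi x) x (tau (phi x)) (Vd _ Vx) (ballxx _ d0) (tauP _ Vx).1.
  rewrite big1 => [|a _]; last first.
    rewrite (tauP _ Vx).2 /tangential big1 ?subrr ?mulr0// => j _.
    by rewrite subrr mul0r.
  by rewrite lerNr oppr0 pmulr_rle0.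
- by move=> y Vy; exact: (tauP y Vy).2.
Qed.

(** * The 2-jet of the stationary parameter along a smooth map *)

Section Jet.
Context {R : realType} {n r k : nat} (phi : 'rV[R]_n -> 'rV[R]_r).
Hypothesis phi_smooth : smooth_on setT phi.
Hypothesis phi_immersion :
  forall x, injective ('d phi x : 'rV[R]_n -> 'rV[R]_r).
Variables (O : set 'rV[R]_k) (gamma : 'rV[R]_k -> 'rV[R]_r)
  (T : 'rV[R]_k -> 'rV[R]_n) (x : 'rV[R]_n).
Hypotheses (O_open : open O) (O0 : O 0).
Hypothesis gamma_smooth : forall s c, Ckf s O (fun u => gamma u 0 c).
Hypothesis T_smooth : forall s b, Ckf s O (fun u => T u 0 b).
Hypotheses (gamma0 : gamma 0 = phi x) (T0 : T 0 = x).
Hypothesis tangential0 : forall u, O u -> forall a, tangential phi (gamma u) (T u) a = 0.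

Variable al : 'I_k.
Let D (f : 'rV[R]_k -> R) (u : 'rV[R]_k) : R := 'D_(delta_mx 0 al) f u.

Let Ckf_D s f : Ckf s.+1 O f -> Ckf s O (D f).
Proof. by move=> [_]; exact. Qed.

Let diffO f u : Ckf 1 O f -> O u -> differentiable f u.
Proof. by move=> [df _] Ou; exact: df. Qed.

Let D_eq f g : (forall u, O u -> f u = g u) -> D f 0 = D g 0.
Proof.
move=> fg; apply: near_eq_derive; apply: filterS fg _.
exact: open_nbhs_nbhs.
Qed.

Let gam c u := gamma u 0 c.
Let Tc b u := T u 0 b.
Let q a c u := d1 phi (T u) a c.
Let p c u := gamma u 0 c - phi (T u) 0 c.

Let q_smooth s a c : Ckf s O (q a c).
Proof.
exact: (Ckf_comp O_open (fun _ _ => I) (Ckf_d1 phi_smooth s a c) (T_smooth s)).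
Qed.

Let p_smooth s c : Ckf s O (p c).
Proof.
apply: (CkfB O_open (gamma_smooth s c)).
exact: (Ckf_comp O_open (fun _ _ => I) (Ckf_phi phi_smooth s c) (T_smooth s)).
Qed.

Let diffT u : O u -> differentiable T u.
Proof.
by move=> Ou; apply/differentiable_coordP => b; exact: diffO (T_smooth 1 b) Ou.
Qed.

Let Dq a c u : O u -> D (q a c) u = \sum_b D (Tc b) u * d2 phi (T u) b a c.
Proof.
move=> Ou; rewrite /D /q (@derive_chain _ _ _ (fun t => d1 phi t a c) T).
- by apply: eq_bigr => b _; rewrite derive_d1.
- exact: diffT.
- exact: differentiable_d1.
Qed.

Let Dp c u : O u -> D (p c) u = D (gam c) u - \sum_b D (Tc b) u * q b c u.
Proof.
move=> Ou; rewrite /D /p derive_pointB; first last.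
- apply: (@differentiable_comp _ _ _ _ T (fun t => phi t 0 c)).
    exact: diffT.
  exact: differentiable_phi_coord.
- exact: diffO (gamma_smooth 1 c) Ou.
congr (_ - _); rewrite (@derive_chain _ _ _ (fun t => phi t 0 c) T).
- by apply: eq_bigr => b _; congr (_ * _); exact: derive_phi_coord.
- exact: diffT.
- exact: differentiable_phi_coord.
Qed.

Let DF a u : O u -> \sum_c (p c u * D (q a c) u + q a c u * D (p c) u) = 0.
Proof.
move=> Ou.
have dp c : differentiable (p c) u by exact: diffO (p_smooth 1 c) Ou.
have dq c : differentiable (q a c) u by exact: diffO (q_smooth 1 a c) Ou.
have <- : D (fun u => \sum_c p c u * q a c u) u =
    \sum_c (p c u * D (q a c) u + q a c u * D (p c) u).
  rewrite /D derive_point_sum; last by move=> c; exact: differentiableM.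
  by apply: eq_bigr => c _; rewrite derive_pointM.
rewrite /D -[RHS](derive_cst (0 : R) u (delta_mx 0 al)); apply: near_eq_derive.
apply: filterS (open_nbhs_nbhs (conj O_open Ou)) => w Ow.
exact: tangential0.
Qed.

Let DDF a : \sum_c (p c 0 * D (D (q a c)) 0 + D (q a c) 0 * D (p c) 0
  + (q a c 0 * D (D (p c)) 0 + D (p c) 0 * D (q a c) 0)) = 0.
Proof.
have dp c : differentiable (p c) 0 by exact: diffO (p_smooth 1 c) O0.
have dq c : differentiable (q a c) 0 by exact: diffO (q_smooth 1 a c) O0.
have ddp c : differentiable (D (p c)) 0.
  exact: diffO (Ckf_D (p_smooth 2 c)) O0.
have ddq c : differentiable (D (q a c)) 0.
  exact: diffO (Ckf_D (q_smooth 2 a c)) O0.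
pose s c u := p c u * D (q a c) u + q a c u * D (p c) u.
have ds c : differentiable (s c) 0.
  by apply: differentiableD; exact: differentiableM.
have E : D (fun u => \sum_c s c u) 0 = 0.
  by rewrite (D_eq (DF a)); exact: derive_cst.
have Es : D (fun u => \sum_c s c u) 0 = \sum_c D (s c) 0.
  exact: derive_point_sum.
transitivity (\sum_c D (s c) 0); last by rewrite -Es.
apply: eq_bigr => c _; rewrite [RHS]deriveD; first last.
- by apply/diff_derivable/differentiableM.
- by apply/diff_derivable/differentiableM.
by rewrite derive_pointM// derive_pointM.
Qed.

Let DDp c : D (D (p c)) 0 = D (D (gam c)) 0
  - \sum_b (D (Tc b) 0 * D (q b c) 0 + q b c 0 * D (D (Tc b)) 0).
Proof.
rewrite (D_eq (Dp c)) {1}/D derive_pointB; first last.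
- have dsum b : differentiable (fun u => D (Tc b) u * q b c u) 0.
    apply: differentiableM; first exact: diffO (Ckf_D (T_smooth 2 b)) O0.
    exact: diffO (q_smooth 1 b c) O0.
  have -> : (fun u => \sum_b D (Tc b) u * q b c u) =
      \sum_b (fun u => D (Tc b) u * q b c u).
    by apply/funext => u; rewrite fct_sumE.
  exact: differentiable_sum.
- exact: diffO (Ckf_D (gamma_smooth 2 c)) O0.
congr (_ - _); rewrite derive_point_sum => [|b].
  apply: eq_bigr => b _; rewrite derive_pointM//.
    exact: diffO (Ckf_D (T_smooth 2 b)) O0.
  exact: diffO (q_smooth 1 b c) O0.
apply: differentiableM; first exact: diffO (Ckf_D (T_smooth 2 b)) O0.
exact: diffO (q_smooth 1 b c) O0.
Qed.

Let p0 c : p c 0 = 0.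
Proof. by rewrite /p gamma0 T0 subrr. Qed.

Let q0 a c : q a c 0 = d1 phi x a c.
Proof. by rewrite /q T0. Qed.

Let gram_sum a (z : 'I_n -> R) :
  \sum_b h_mx phi x a b * z b =
  \sum_c d1 phi x a c * \sum_b z b * d1 phi x b c.
Proof.
under [RHS]eq_bigr do rewrite mulr_sumr.
rewrite [RHS]exchange_big; apply: eq_bigr => b _; rewrite mxE mulr_suml.
by apply: eq_bigr => c _; rewrite -mulrA [z b * _]mulrC.
Qed.

Lemma stationary_jet1 a : 'D_(delta_mx 0 al) (fun u => T u 0 a) 0 =
  \sum_c Pi_mx phi x a c * 'D_(delta_mx 0 al) (fun u => gamma u 0 c) 0.
Proof.
have := @gram_solve _ _ _ _ phi_smooth phi_immersion x
  (fun b => D (Tc b) 0) (fun c => D (gam c) 0) (fun=> 0).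
move=> hs; apply: (etrans (hs _ a)) => [a'|]; last first.
  by rewrite [X in _ + X]big1 ?addr0// => b _; rewrite mulr0.
rewrite addr0 gram_sum; apply/esym/eqP; rewrite -subr_eq0 -sumrB.
rewrite -[eqbRHS](DF a' O0); apply/eqP/eq_bigr => c _.
rewrite p0 mul0r add0r (Dp _ O0) q0 -mulrBr; congr (_ * (_ - _)).
by apply: eq_bigr => b _; rewrite q0.
Qed.

(** The second derivative of [sum_c p_c q_ac = 0] at 0, where [p_c] vanishes, reads
    [sum_c (2 q_ac' p_c' + q_ac p_c'') = 0]; the second derivative of [T] enters only
    through [p_c''], with matrix [h]. *)
Lemma stationary_jet2 i (t' := fun b => 'D_(delta_mx 0 al) (fun u => T u 0 b) 0)
    (g' := fun c => 'D_(delta_mx 0 al) (fun u => gamma u 0 c) 0) :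
  'D_(delta_mx 0 al) (fun u => 'D_(delta_mx 0 al) (fun w => T w 0 i) u) 0 =
  \sum_c Pi_mx phi x i c *
    ('D_(delta_mx 0 al) (fun u => 'D_(delta_mx 0 al) (fun w => gamma w 0 c) u) 0
     - \sum_b \sum_b' d2 phi x b b' c * t' b * t' b')
  + \sum_a invmx (h_mx phi x) i a *
      (2 * \sum_c (\sum_b d2 phi x a b c * t' b)
             * (g' c - \sum_b t' b * d1 phi x b c)).
Proof.
apply: (@gram_solve _ _ _ _ phi_smooth phi_immersion x
  (fun b => D (D (Tc b)) 0)) => a.
have Dq0 a' c : D (q a' c) 0 = \sum_b d2 phi x a' b c * t' b.
  by rewrite Dq// T0; apply: eq_bigr => b _; rewrite mulrC d2C.
have Dp0 c : D (p c) 0 = g' c - \sum_b t' b * d1 phi x b c.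
  by rewrite (Dp _ O0); congr (_ - _); apply: eq_bigr => b _; rewrite q0.
have DDp0 c : D (D (p c)) 0 = D (D (gam c)) 0
    - \sum_b \sum_b' d2 phi x b b' c * t' b * t' b'
    - \sum_b D (D (Tc b)) 0 * d1 phi x b c.
  rewrite DDp big_split/= opprD addrA; congr (_ - _ - _).
    apply: eq_bigr => b _; rewrite Dq0 mulr_sumr.
    by apply: eq_bigr => b' _; rewrite mulrCA mulrA.
  by apply: eq_bigr => b _; rewrite q0 mulrC.
rewrite gram_sum; apply/esym/eqP; rewrite -subr_eq0 mulr_sumr addrAC -sumrB.
rewrite -big_split/= -[eqbRHS](DDF a); apply/eqP/eq_bigr => c _.
rewrite p0 mul0r add0r q0 Dq0 Dp0 DDp0 -[X in _ * (X - _)]/(D (D (gam c)) 0).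
by ring.
Qed.

End Jet.

(** * Contraction of the jet with the diffusion coefficients *)

Section Contraction.
Context {R : realType}.

Lemma sum_pull {p q m : nat} (F : 'I_m -> 'I_p -> 'I_q -> R) (G : 'I_p -> 'I_q -> R) :
  \sum_de \sum_ep (\sum_s F s de ep) * G de ep =
  \sum_s \sum_de \sum_ep F s de ep * G de ep.
Proof.
rewrite [RHS]exchange_big; apply: eq_bigr => de _.
by rewrite [RHS]exchange_big; apply: eq_bigr => ep _; rewrite mulr_suml.
Qed.

Lemma sum_outer {p q : nat} (K : R) (A g : 'I_p -> R) (B g' : 'I_q -> R) F :
  (forall de ep, F de ep = K * A de * B ep) ->
  \sum_de \sum_ep F de ep * (g de * g' ep) =
  K * (\sum_de A de * g de) * (\sum_ep B ep * g' ep).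
Proof.
move=> FE; rewrite -mulrA big_distrlr mulr_sumr; apply: eq_bigr => de _.
rewrite mulr_sumr; apply: eq_bigr => ep _; rewrite FE /=; ring.
Qed.

(** Both sides are quadratic in [g]: on the left the coefficients are contracted
    with [g] last, on the right [t = P g] is formed first.  The hypothesis on [J]
    holds for [P = Pi_mx] and absorbs the factor [h] of the last term. *)
Lemma jet_contraction {n r : nat} (P J : 'I_n -> 'I_r -> R)
    (dd : 'I_n -> 'I_n -> 'I_r -> R) (h hinv : 'I_n -> 'I_n -> R)
    (g : 'I_r -> R) (t : 'I_n -> R) i :
  (forall b, t b = \sum_c P b c * g c) ->
  (forall ze ga, \sum_et P et ga * h et ze = J ze ga) ->
  \sum_(de < r) \sum_(ep < r)
     (- (2^-1 * \sum_(ga < r) \sum_(al < n) \sum_(be < n)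
           dd al be ga * P i ga * P al de * P be ep)
      + (\sum_(al < n) \sum_(be < n) dd al be ep * P be de * hinv i al)
      - (\sum_(ga < r) \sum_(al < n) \sum_(be < n)
           \sum_(et < n) \sum_(ze < n)
           dd al be ga * P be ep * P et ga * P ze de * h et ze * hinv i al))
     * (g de * g ep) =
  - (2^-1 * \sum_c P i c * \sum_b \sum_b' dd b b' c * t b * t b')
  + \sum_a hinv i a * \sum_c (\sum_b dd a b c * t b) * (g c - \sum_b t b * J b c).
Proof.
move=> ht hJ.
have -> (A B C : 'I_r -> 'I_r -> R) :
    \sum_de \sum_ep (- (2^-1 * A de ep) + B de ep - C de ep) * (g de * g ep) =
    - (2^-1 * \sum_de \sum_ep A de ep * (g de * g ep))
    + (\sum_de \sum_ep B de ep * (g de * g ep)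
       - \sum_de \sum_ep C de ep * (g de * g ep)).
  rewrite mulr_sumr -sumrN -sumrB -big_split; apply: eq_bigr => de _ /=.
  rewrite mulr_sumr -sumrN -sumrB -big_split; apply: eq_bigr => ep _ /=.
  ring.
congr (- (_ * _) + _).
  rewrite sum_pull; apply: eq_bigr => ga _.
  rewrite sum_pull mulr_sumr; apply: eq_bigr => al _.
  rewrite sum_pull mulr_sumr; apply: eq_bigr => be _.
  rewrite (@sum_outer _ _ (dd al be ga * P i ga) (P al) g (P be) g)//.
  by rewrite -!ht; ring.
have -> : \sum_de \sum_ep
    (\sum_al \sum_be dd al be ep * P be de * hinv i al) * (g de * g ep) =
    \sum_al hinv i al * \sum_c (\sum_be dd al be c * t be) * g c.
  rewrite sum_pull; apply: eq_bigr => al _; rewrite sum_pull.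
  under [in RHS]eq_bigr do rewrite mulr_suml.
  rewrite [in RHS]exchange_big mulr_sumr; apply: eq_bigr => be _ /=.
  rewrite (@sum_outer _ _ (hinv i al) (P be) g (dd al be) g); last first.
    by move=> de ep; ring.
  rewrite -ht -mulrA; congr (_ * _); rewrite mulr_sumr.
  by apply: eq_bigr => c _; ring.
have -> : \sum_de \sum_ep
    (\sum_ga \sum_al \sum_be \sum_et \sum_ze
       dd al be ga * P be ep * P et ga * P ze de * h et ze * hinv i al)
      * (g de * g ep) =
    \sum_al hinv i al * \sum_c (\sum_be dd al be c * t be) * (\sum_b t b * J b c).
  rewrite sum_pull; under eq_bigr do rewrite sum_pull.
  rewrite exchange_big; apply: eq_bigr => al _.
  rewrite mulr_sumr; apply: eq_bigr => ga _.
  rewrite sum_pull mulr_suml mulr_sumr; apply: eq_bigr => be _.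
  rewrite sum_pull.
  under eq_bigr do rewrite sum_pull.
  rewrite exchange_big mulr_sumr mulr_sumr; apply: eq_bigr => ze _.
  rewrite (_ : _ * (dd al be ga * t be * (t ze * J ze ga)) =
    J ze ga * (hinv i al * (dd al be ga * t be) * t ze)); last by ring.
  rewrite -hJ mulr_suml; apply: eq_bigr => et _.
  rewrite (@sum_outer _ _ (dd al be ga * P et ga * h et ze * hinv i al)
    (P ze) g (P be) g); last by move=> de ep; ring.
  by rewrite -!ht; ring.
rewrite -sumrB; apply: eq_bigr => al _; rewrite -mulrBr -sumrB; congr (_ * _).
by apply: eq_bigr => c _; rewrite mulrBr.
Qed.

Lemma sum_delta {k p q : nat} (F : 'I_p -> 'I_q -> R) (b : 'I_k -> 'I_p -> R)
    (b' : 'I_k -> 'I_q -> R) :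
  \sum_de \sum_ep F de ep * (\sum_(ka < k) \sum_(io < k)
     b ka de * b' io ep * (ka == io)%:R) =
  \sum_ka \sum_de \sum_ep F de ep * (b ka de * b' ka ep).
Proof.
rewrite [RHS]exchange_big; apply: eq_bigr => de _.
rewrite [RHS]exchange_big; apply: eq_bigr => ep _.
rewrite mulr_sumr; apply: eq_bigr => ka _; congr (_ * _).
rewrite (bigD1 ka)//= eqxx mulr1 big1 ?addr0// => io.
by rewrite eq_sym => /negbTE ->; rewrite mulr0.
Qed.

Lemma half_sum_split {p q : nat} (P X Y : 'I_p -> R) (H Z : 'I_q -> R) :
  2^-1 * (\sum_c P c * (X c - Y c) + \sum_a H a * (2 * Z a)) =
  2^-1 * \sum_c P c * X c
  + (- (2^-1 * \sum_c P c * Y c) + \sum_a H a * Z a).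
Proof.
have -> : \sum_c P c * (X c - Y c) = \sum_c P c * X c - \sum_c P c * Y c.
  by rewrite -sumrB; apply: eq_bigr => c _; rewrite mulrBr.
have -> : \sum_a H a * (2 * Z a) = 2 * \sum_a H a * Z a.
  by rewrite mulr_sumr; apply: eq_bigr => a _; rewrite mulrCA.
by field.
Qed.

End Contraction.

Theorem theorem5 (R : realType) (n r k : nat) (phi : 'rV[R]_n -> 'rV[R]_r)
    (a : 'rV[R]_r -> 'rV[R]_r) (b : 'I_k -> 'rV[R]_r -> 'rV[R]_r)
    (x0 : 'rV[R]_n) (y0 : 'rV[R]_r) :
  smooth_embedding phi ->
  phi x0 = y0 ->
  let A (x : 'rV[R]_n) : 'rV[R]_n :=
    let h := h_mx phi x in
    let hinv := invmx h in
    let P := Pi_mx phi x in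
    let dd := d2 phi x in
    \row_(i < n)
      (\sum_(al < r) P i al * a (phi x) 0 al
       + \sum_(de < r) \sum_(ep < r)
           (- (2^-1 * \sum_(ga < r) \sum_(al < n) \sum_(be < n)
                 dd al be ga * P i ga * P al de * P be ep)
            + (\sum_(al < n) \sum_(be < n)
                 dd al be ep * P be de * hinv i al)
            - (\sum_(ga < r) \sum_(al < n) \sum_(be < n)
                 \sum_(et < n) \sum_(ze < n)
                 dd al be ga * P be ep * P et ga * P ze de
                   * h et ze * hinv i al))
           * (\sum_(ka < k) \sum_(io < k)
                b ka (phi x) 0 de * b io (phi x) 0 ep * (ka == io)%:R)) in
  let B (al : 'I_k) (x : 'rV[R]_n) : 'rV[R]_n :=
    \row_(i < n) \sum_(be < r) Pi_mx phi x i be * b al (phi x) 0 be in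
  is_ito_jet_projection phi (Sde a b y0) (Sde A B x0).
Proof.
move=> phi_emb phi_x0 A B; have [phi_smooth _ phi_imm _] := phi_emb.
split=> // x; split; first exact: metric_projection_exists.
move=> gamma Pis gammaP Pis_near.
have [gs g0 /= gdrift gdiff] := gammaP (phi x).
set g := gamma (phi x) in gs g0 gdrift gdiff *.
have [V [oV Vx tau_smooth taux tau_tan]] := metric_projection_smooth phi_emb Pis_near.
have gC s c : Ckf s setT (fun u => g u 0 c).
  exact: (Ck_onP s g openT).1 (gs s) c.
pose O := g @^-1` V.
have oO : open O.
  apply: open_comp => // u _; apply: continuous_row => c.
  exact: (gC 0 c).
have O0 : O 0 by rewrite /O /= g0.
have gCO s c : Ckf s O (fun u => g u 0 c) by exact: Ckf_sub (gC s c).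
pose tau : 'rV[R]_r -> 'rV[R]_n := pinv setT phi \o Pis.
pose T : 'rV[R]_k -> 'rV[R]_n := tau \o g.
have T_smooth s i : Ckf s O (fun u => T u 0 i).
  exact: (@Ckf_comp _ s _ _ O V (fun y => tau y 0 i) g oO (fun _ Ou => Ou)
    (tau_smooth s i) (gCO s)).
have T0 : T 0 = x by rewrite /T /= g0.
have T_tan u : O u -> forall i, tangential phi (g u) (T u) i = 0.
  by move=> Ou; exact: tau_tan.
have Ts : smooth_on O T by move=> s; apply/Ck_onP.
exists O; first by split.
have j1 al i := stationary_jet1 phi_smooth phi_imm oO O0 gCO T_smooth g0 T0 T_tan al i.
have j2 al i := stationary_jet2 phi_smooth phi_imm oO O0 gCO T_smooth g0 T0 T_tan al i.
have b_g al c : 'D_(delta_mx 0 al) (fun u => g u 0 c) 0 = b al (phi x) 0 c.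
  by rewrite gdiff /partial derive_coord//; exact: (gs 1).1.
have a_g c : a (phi x) 0 c = 2^-1 * \sum_al
    'D_(delta_mx 0 al) (fun u => 'D_(delta_mx 0 al) (fun w => g w 0 c) u) 0.
  rewrite gdrift mxE summxE; congr (_ * _); apply: eq_bigr => al _.
  exact: (partial2_coord _ _ _ openT I gs).
have B_T al i : 'D_(delta_mx 0 al) (fun u => T u 0 i) 0 = B al x 0 i.
  by rewrite j1 mxE; apply: eq_bigr => c _; rewrite b_g.
have dT : differentiable T 0 by exact: (Ts 1).1.
split=> //=; last first.
  by move=> al; apply/rowP => i; rewrite -B_T /partial derive_coord.
apply/rowP => i; rewrite [RHS]mxE summxE.
transitivity (2^-1 * \sum_al
    'D_(delta_mx 0 al) (fun u => 'D_(delta_mx 0 al) (fun w => T w 0 i) u) 0);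
  last first.
  congr (_ * _); apply: eq_bigr => al _; apply/esym.
  exact: (partial2_coord _ _ _ oO O0 Ts).
rewrite mxE sum_delta.
have -> : \sum_c Pi_mx phi x i c * a (phi x) 0 c = 2^-1 * \sum_al \sum_c
    Pi_mx phi x i c * 'D_(delta_mx 0 al) (fun u => 'D_(delta_mx 0 al) (fun w => g w 0 c) u) 0.
  rewrite exchange_big mulr_sumr; apply: eq_bigr => c _.
  by rewrite a_g -mulr_sumr mulrCA.
rewrite !mulr_sumr -big_split; apply: eq_bigr => al _ /=.
rewrite (@jet_contraction _ _ _ _ (d1 phi x) _ _ _ _
  (fun b' => 'D_(delta_mx 0 al) (fun u => T u 0 b') 0)); last 2 first.
- by move=> b'; rewrite B_T mxE.
- move=> ze ga.
  have := h_Pi_mx phi_smooth phi_imm x => /matrixP/(_ ze ga).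
  rewrite [RHS]mxE => <-; rewrite mxE; apply: eq_bigr => et _.
  by rewrite mulrC h_mxC.
rewrite j2 [RHS]half_sum_split; congr (_ + (_ + _)).
apply: eq_bigr => a' _; congr (_ * _); apply: eq_bigr => c _; congr (_ * (_ - _)).
by rewrite b_g.
Qed.
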